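(* There exist uncountably many distinct infinite pin words $w$ with $\mathrm{gr}(\mathcal{C}_w)=\mu$, where $\mu\approx 3.28277$ is the largest real zero of $z^5-4z^4+3z^3-2z^2-z+2$.
   Context: Gridded permutations: a (gridded) permutation is a finite set of points in $\mathbb{R}^2$, no two sharing an $x$- or $y$-coordinate and none on the coordinate axes, where two such sets are regarded as equal if there is a bijection between them preserving the relative horizontal order, the relative vertical order, and the quadrant of every point (quadrants 1,2,3,4 are top-right, top-left, bottom-left, bottom-right). Its length is its number of points. $\sigma\le\pi$ ($\sigma$ is contained in $\pi$, possibly infinite) if some subset of the points of $\pi$ equals $\sigma$ in this sense. For a set $\mathcal{C}$ of gridded permutations let $\mathcal{C}_n$ be its elements of length $n$ and $\mathrm{gr}(\mathcal{C})=\lim_{n\to\infty}|\mathcal{C}_n|^{1/n}$ (this limit exists for all pin classes). Pin words: let $\mathcal{A}=\{\mathsf{l}_\mathsf{u},\mathsf{l}_\mathsf{d},\mathsf{r}_\mathsf{u},\mathsf{r}_\mathsf{d},\mathsf{u}_\mathsf{l},\mathsf{u}_\mathsf{r},\mathsf{d}_\mathsf{l},\mathsf{d}_\mathsf{r}\}$. A pin word (finite or infinite) is a word over $\mathcal{A}$ in which every letter $x_y$ that is followed by a letter is followed by a letter of the form $z_x$ with $z$ perpendicular to $x$ (i.e. $z\in\{\mathsf{u},\mathsf{d}\}$ if $x\in\{\mathsf{l},\mathsf{r}\}$ and vice versa). The quadrant of a letter is determined by its two symbols: $\{\mathsf{r},\mathsf{u}\}\mapsto1$, $\{\mathsf{l},\mathsf{u}\}\mapsto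 2$, $\{\mathsf{l},\mathsf{d}\}\mapsto3$, $\{\mathsf{r},\mathsf{d}\}\mapsto4$. A pin word $w=w_1w_2\cdots$ determines the gridded permutation $\pi_w$ with points $p_1,p_2,\dots$: $p_1$ is a point in the quadrant of $w_1$; for $i\ge2$, if $w_i=x_y$ then $p_i$ lies outside the smallest axis-parallel rectangle containing the origin and $p_1,\dots,p_{i-1}$, on its side in direction $x$ (left, right, up, down), and lies horizontally or vertically strictly between $p_{i-1}$ and the smallest axis-parallel rectangle containing the origin and $p_1,\dots,p_{i-2}$. This determines $\pi_w$ uniquely, and $p_i$ lies in the quadrant of $w_i$. The pin class of an infinite pin word $w$ is $\mathcal{C}_w=\{\sigma \text{ finite}:\sigma\le\pi_w\}$. *)

(* Defs.v *)
From HB Require Import structures.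
From mathcomp Require Import all_boot all_order all_algebra finmap.
From mathcomp Require Import generic_quotient.
From mathcomp Require Import all_classical all_reals all_analysis.

Set Implicit Arguments.
Unset Strict Implicit.
Unset Printing Implicit Defensive.
Import Order.TTheory GRing.Theory Num.Theory.
Import numFieldNormedType.Exports.
Local Open Scope classical_set_scope.
Local Open Scope ring_scope.

Variant quadrant := Q1 | Q2 | Q3 | Q4.

Definition in_quadrant (R : realType) (q : quadrant) (a : R * R) : bool :=
  match q with
  | Q1 => (0 < a.1) && (0 < a.2)
  | Q2 => (a.1 < 0) && (0 < a.2)
  | Q3 => (a.1 < 0) && (a.2 < 0)
  | Q4 => (0 < a.1) && (a.2 < 0)
  end.

Section GriddedPermutations.
Variable R : realType.

Definition gridded (A : {fset R * R}) : Prop :=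
  [/\ {in A &, forall a b : R * R, a.1 = b.1 -> a = b},
      {in A &, forall a b : R * R, a.2 = b.2 -> a = b} &
      {in A, forall a, a.1 != 0 /\ a.2 != 0}].

Record gpoints := GPoints { points :> {fset R * R}; _ : `[< gridded points >] }.

HB.instance Definition _ := [isSub for points].
HB.instance Definition _ := [Choice of gpoints by <:].

Definition same_gridding (A B : gpoints) : Prop :=
  exists f : R * R -> R * R,
    [/\ set_bij [set` points A] [set` points B] f,
        {in points A &, forall a b, ((f a).1 < (f b).1) = (a.1 < b.1)},
        {in points A &, forall a b, ((f a).2 < (f b).2) = (a.2 < b.2)} &
        {in points A, forall a q, in_quadrant q (f a) = in_quadrant q a}].

Definition same_griddingb : rel gpoints := fun A B => `[< same_gridding A B >].

Lemma same_gridding_refl : reflexive same_griddingb.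
Proof. by move=> A; apply/asboolP; exists id; split => //; split => // b bA; exists b. Qed.

Lemma same_gridding_symP (A B : gpoints) :
  same_gridding A B -> same_gridding B A.
Proof.
case=> f [fAB fx fy fq].
pose g := 'pinv_(fun=> (0, 0)) [set` points A] f.
have gBA : set_bij [set` points B] [set` points A] g by exact: bijpinv_bij.
have gA b : b \in points B -> g b \in points A.
  by move=> bB; exact: (set_bij_homo gBA).
have fg b : b \in points B -> f (g b) = b.
  move=> bB; apply: pinvK; rewrite inE.
  exact: set_bij_surj fAB b bB.
exists g; split => // [a b aB bB|a b aB bB|b bB q].
- by rewrite -fx ?gA// !fg.
- by rewrite -fy ?gA// !fg.
- by rewrite -fq ?gA// !fg.
Qed.

Lemma same_gridding_sym : symmetric same_griddingb.
Proof.
by move=> A B; apply/asboolP/asboolP => /same_gridding_symP.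
Qed.

Lemma same_gridding_trans : transitive same_griddingb.
Proof.
move=> B A C /asboolP[f [fAB fx fy fq]] /asboolP[g [gBC gx gy gq]].
have fB a : a \in points A -> f a \in points B.
  by move=> aA; exact: (set_bij_homo fAB).
apply/asboolP; exists (g \o f); split.
- exact: set_bij_comp fAB gBC.
- by move=> a b aA bA /=; rewrite gx ?fB// fx.
- by move=> a b aA bA /=; rewrite gy ?fB// fy.
- by move=> a aA q /=; rewrite gq ?fB// fq.
Qed.

Canonical same_gridding_equiv :=
  EquivRel same_griddingb same_gridding_refl same_gridding_sym
    same_gridding_trans.

Definition gperm := {eq_quot same_griddingb}%qT.

HB.instance Definition _ := Choice.on gperm.
HB.instance Definition _ := EqQuotient.on gperm.

(* Well defined on classes: same_gridding requires a bijection. *)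
Definition glength (s : gperm) : nat := #|` points (repr s)|.

Definition contained (s : gperm) (P : set (R * R)) : Prop :=
  exists2 A : gpoints, s = (\pi_gperm A)%qT & [set` points A] `<=` P.

Lemma finite_glength (n : nat) : finite_set [set s : gperm | glength s = n].
Proof.
pose l (s : gperm) : seq (R * R) := enum_fset (points (repr s)).
pose e (s : gperm) (i : nat) : R * R := nth (0, 0) (l s) i.
pose code (s : gperm) :
    {ffun 'I_n * 'I_n -> bool * bool} *
    {ffun 'I_n -> bool * bool * bool * bool} :=
  ([ffun ij : 'I_n * 'I_n =>
    (((e s ij.1).1 < (e s ij.2).1), ((e s ij.1).2 < (e s ij.2).2))],
   [ffun i : 'I_n => (in_quadrant Q1 (e s i), in_quadrant Q2 (e s i),
                      in_quadrant Q3 (e s i), in_quadrant Q4 (e s i))]).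
suff codeI : {in [set s : gperm | glength s = n] &, injective code}.
  by rewrite -(eq_finite_set (inj_card_eq codeI)); exact: finite_finset.
move=> s t; rewrite !inE /= => sn tn [/ffunP/= st1 /ffunP/= st2].
have lsn : size (l s) = n by [].
have ltn : size (l t) = n by [].
have ix a : a \in points (repr s) -> (index a (l s) < n)%N.
  by rewrite -[in X in _ -> X]lsn index_mem.
have ex a : a \in points (repr s) -> e s (index a (l s)) = a.
  by move=> ?; rewrite /e nth_index.
rewrite -[s]reprK -[t]reprK; apply/eqmodP/asboolP.
exists (fun a => e t (index a (l s))); split.
- split.
  + by move=> a /ix ia; apply/mem_nth; rewrite ltn.
  + move=> a b; rewrite !inE => aA bA /eqP.
    rewrite nth_uniq ?ltn ?ix ?fset_uniq// => /eqP ab.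
    by rewrite -(ex a aA) ab ex.
  + move=> b /= bB; have ib : (index b (l t) < n)%N by rewrite -ltn index_mem.
    exists (e s (index b (l t))); first by apply/mem_nth; rewrite lsn.
    by rewrite /e index_uniq ?lsn ?fset_uniq// nth_index.
- move=> a b aA bA; have := st1 (Ordinal (ix a aA), Ordinal (ix b bA)).
  by rewrite !ffunE/= !ex// => -[].
- move=> a b aA bA; have := st1 (Ordinal (ix a aA), Ordinal (ix b bA)).
  by rewrite !ffunE/= !ex// => -[].
- move=> a aA q; have := st2 (Ordinal (ix a aA)).
  by rewrite !ffunE/= !ex// => -[q1 q2 q3 q4]; case: q.
Qed.

(* By finite_glength the default value of fset_set on infinite sets is never
   used. *)
Definition num_of_length (C : set gperm) (n : nat) : nat :=
  #|` fset_set [set s | C s /\ glength s = n]|.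

Definition has_growth_rate (C : set gperm) (g : R) : Prop :=
  (fun n : nat => (num_of_length C n)%:R `^ n%:R^-1) @ \oo --> g.

End GriddedPermutations.

Variant direction := Left | Right | Up | Down.

Definition perpendicular (x y : direction) : bool :=
  match x, y with
  | (Left | Right), (Up | Down) | (Up | Down), (Left | Right) => true
  | _, _ => false
  end.

(* The letter x_y; for instance lu is l_u, with main symbol l, subscript u. *)
Variant letter := lu | ld | ru | rd | ul | ur | dl | dr.

Definition main_symbol (c : letter) : direction :=
  match c with
  | lu | ld => Left | ru | rd => Right | ul | ur => Up | dl | dr => Down
  end.

Definition subscript (c : letter) : direction :=
  match c with
  | ul | dl => Left | ur | dr => Right | lu | ru => Up | ld | rd => Down
  end.

Definition letter_quadrant (c : letter) : quadrant :=
  match c with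
  | ru | ur => Q1 | lu | ul => Q2 | ld | dl => Q3 | rd | dr => Q4
  end.

(* Infinite words are indexed from 0: w 0 is the first letter w_1. *)
Definition pin_word (w : nat -> letter) : Prop :=
  forall i, subscript (w i.+1) = main_symbol (w i) /\
            perpendicular (main_symbol (w i.+1)) (main_symbol (w i)).

Section PinClasses.
Variable R : realType.
Implicit Types (p : nat -> R * R) (a b : R * R).

(* The sides of the smallest axis-parallel rectangle containing the origin and
   the first k points p 0, ..., p k.-1. *)
Definition rect_left p (k : nat) : R := \big[Num.min/0]_(j < k) (p j).1.
Definition rect_right p (k : nat) : R := \big[Num.max/0]_(j < k) (p j).1.
Definition rect_bottom p (k : nat) : R := \big[Num.min/0]_(j < k) (p j).2.
Definition rect_top p (k : nat) : R := \big[Num.max/0]_(j < k) (p j).2.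

Definition beyond_rect p (k : nat) (d : direction) a : bool :=
  match d with
  | Left => a.1 < rect_left p k
  | Right => rect_right p k < a.1
  | Up => rect_top p k < a.2
  | Down => a.2 < rect_bottom p k
  end.

Definition hbetween_rect p (k : nat) a b : bool :=
  (rect_right p k < a.1 < b.1) || (b.1 < a.1 < rect_left p k).

Definition vbetween_rect p (k : nat) a b : bool :=
  (rect_top p k < a.2 < b.2) || (b.2 < a.2 < rect_bottom p k).

Definition pin_sequence (w : nat -> letter) p : Prop :=
  in_quadrant (letter_quadrant (w 0%N)) (p 0%N) /\
  forall i, beyond_rect p i.+1 (main_symbol (w i.+1)) (p i.+1) /\
            (hbetween_rect p i (p i.+1) (p i) \/
             vbetween_rect p i (p i.+1) (p i)).

(* The gridded permutation pi_w is the common gridded order type of all pin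
   sequences of w. *)
Definition pin_class (w : nat -> letter) : set (gperm R) :=
  [set s | exists2 p, pin_sequence w p & contained s (range p)].

End PinClasses.

Definition mu_poly (R : realType) : {poly R} :=
  'X^5 - 4 *: 'X^4 + 3 *: 'X^3 - 2 *: 'X^2 - 'X + 2%:P.

Definition largest_root (R : realType) (f : {poly R}) (x : R) : Prop :=
  root f x /\ forall y, root f y -> y <= x.

(* Main.v *)
(* A binary word x gives the pin word in which the letter x_i contributes a
   horizontal pin followed by an upward pin, both in quadrant 2 if x_i holds
   and both in quadrant 1 otherwise.  The y-order and, within a quadrant, the
   order of the distances to the vertical axis differ from the order of the
   indices only by swaps of consecutive pins.  Hence a finite set of pins is the
   box sum of its maximal runs of consecutive pins, and its gridded permutation
   is recorded by a word (listing, from bottom to top, the quadrant of each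
   point and the later points that it crosses) for which box sums are
   concatenations.  Up to a few coincidences in lengths 1, 2 and 3, distinct
   runs are distinct and box-indecomposable.

   If x is Sturmian without the factor 11, it has l + 1 factors of length l,
   all recurrent, so the class is freely generated under box sums by 2, 2, 4
   and m + 3 indecomposables of length 1, 2, 3 and m >= 4.  The number f_n of
   its elements thus satisfies a renewal equation whose characteristic
   polynomial is the one in the statement, and mu^n / 30 <= f_n <= mu^n.
   Rotation words of a fixed irrational slope and varying intercept give
   uncountably many such x. *)
Require Import Defs.
From HB Require Import structures.
From mathcomp Require Import all_boot all_order all_algebra finmap.
From mathcomp Require Import generic_quotient.
From mathcomp Require Import all_classical all_reals all_analysis.
From mathcomp Require Import zify ring lra.
Set Implicit Arguments.
Unset Strict Implicit.
Unset Printing Implicit Defensive.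
Import Order.TTheory GRing.Theory Num.Theory.
Import numFieldNormedType.Exports.

(** * Codes of finite sets of pins *)

(* Ranks of the pin of index [i] by height and by distance to the vertical
   axis; the second one is only meaningful within a quadrant. *)
Definition ykey (i : nat) : nat := if odd i then i.+1 else i.-1.
Definition xkey (i : nat) : nat := if odd i then i.-1 else i.+1.

Lemma ykey_inj : injective ykey.
Proof. move=> a b; rewrite /ykey; case: ifP; case: ifP; lia. Qed.

Lemma xkey_inj : injective xkey.
Proof. move=> a b; rewrite /xkey; case: ifP; case: ifP; lia. Qed.

Definition ysort : seq nat -> seq nat := sort (relpre ykey leq).

Definition yltn : rel nat := relpre ykey ltn.

Lemma yltn_trans : transitive yltn.
Proof. by move=> a b c; exact: ltn_trans. Qed.

Lemma yltn_irr : irreflexive yltn.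
Proof. by move=> a; rewrite /yltn /= ltnn. Qed.

Lemma mem_ysort S : ysort S =i S.
Proof. exact: mem_sort. Qed.

Lemma size_ysort S : size (ysort S) = size S.
Proof. exact: size_sort. Qed.

Lemma ysort_uniq S : uniq (ysort S) = uniq S.
Proof. exact: sort_uniq. Qed.

Lemma ysort_sorted S : uniq S -> sorted yltn (ysort S).
Proof.
move=> uS; have : sorted (relpre ykey leq) (ysort S).
  by apply: sort_sorted => a b; exact: leq_total.
rewrite -!sorted_map ltn_sorted_uniq_leq => ->.
by rewrite map_inj_uniq ?ysort_uniq ?uS //; exact: ykey_inj.
Qed.

Lemma eq_ysort S q : uniq S -> sorted yltn q -> q =i S -> ysort S = q.
Proof.
move=> uS sq qS; apply: (irr_sorted_eq yltn_trans yltn_irr) => //.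
  exact: ysort_sorted.
by move=> a; rewrite mem_ysort qS.
Qed.

Lemma ysort_cat S1 S2 : uniq S1 -> uniq S2 ->
  (forall a b, a \in S1 -> b \in S2 -> ykey a < ykey b) ->
  ysort (S1 ++ S2) = ysort S1 ++ ysort S2.
Proof.
move=> u1 u2 lt12; apply: eq_ysort.
- rewrite cat_uniq u1 u2 andbT /=; apply/hasPn => b bS2; apply/negP => bS1.
  by have := lt12 b b bS1 bS2; rewrite ltnn.
- rewrite sorted_pairwise; last exact: yltn_trans.
  rewrite pairwise_cat -!(sorted_pairwise yltn_trans).
  rewrite !ysort_sorted // !andbT; apply/allrelP => a b.
  by rewrite !mem_ysort; exact: lt12.
- by move=> a; rewrite !mem_cat !mem_ysort.
Qed.

Lemma ysort_map (h : nat -> nat) S : uniq S ->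
  {in S &, forall a b, (ykey (h a) < ykey (h b)) = (ykey a < ykey b)} ->
  ysort (map h S) = map h (ysort S).
Proof.
move=> uS hS; have hI : {in S &, injective h}.
  move=> a b aS bS hab; apply: ykey_inj.
  by case: (ltngtP (ykey a) (ykey b)) => //; rewrite -hS // hab ltnn.
apply: eq_ysort; first by rewrite map_inj_in_uniq.
- rewrite sorted_map; apply: (sub_in_sorted (P := mem S)) (ysort_sorted uS).
    by move=> a b aS bS; rewrite /yltn /= hS.
  by apply/allP => a; rewrite mem_ysort.
- move=> b; apply/mapP/mapP => -[a aS ->]; exists a => //; move: aS;
  by rewrite mem_ysort.
Qed.

Section Codes.
Implicit Types (s : nat -> bool) (q : seq nat).

Definition cross s (a b : nat) : bool := (s a == s b) && (xkey b < xkey a).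

(* Offsets, in the list [q] of the points above [a], of the points that lie on
   the same side of the axis as [a] and closer to it. *)
Definition crossings s (a : nat) q : seq nat :=
  [seq k <- iota 0 (size q) | cross s a (nth 0 q k)].

Fixpoint pcode s q : seq (bool * seq nat) :=
  if q is a :: q' then (s a, crossings s a q') :: pcode s q' else [::].

Lemma size_code s q : size (pcode s q) = size q.
Proof. by elim: q => //= a q ->. Qed.

Lemma map_fst_code s q : map fst (pcode s q) = map s q.
Proof. by elim: q => //= a q ->. Qed.

Lemma nth_code s q d j : j < size q ->
  nth d (pcode s q) j = (s (nth 0 q j), crossings s (nth 0 q j) (drop j.+1 q)).
Proof. by elim: q j => //= a q IH [|j] /=; rewrite ?drop0 //; exact: IH. Qed.

Lemma mem_crossings s a q k :
  (k \in crossings s a q) = (k < size q) && cross s a (nth 0 q k).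
Proof. by rewrite mem_filter mem_iota andbC. Qed.

Lemma mem_crossings_pcode s q d j l : j < l -> l < size q ->
  (l - j.+1 \in (nth d (pcode s q) j).2) = cross s (nth 0 q j) (nth 0 q l).
Proof.
move=> jl lq; rewrite nth_code ?(ltn_trans jl) // mem_crossings size_drop nth_drop.
by rewrite subnKC // ltn_sub2r //; apply: leq_ltn_trans lq.
Qed.

Lemma code_cat s q1 q2 :
  (forall a b, a \in q1 -> b \in q2 -> ~~ cross s a b) ->
  pcode s (q1 ++ q2) = pcode s q1 ++ pcode s q2.
Proof.
elim: q1 => //= a q1 IH nc; rewrite IH; last first.
  by move=> b c bq; apply: nc; rewrite inE bq orbT.
congr (_ :: _); congr (_, _); rewrite /crossings size_cat iotaD filter_cat.
rewrite [X in _ ++ X](_ : _ = [::]) ?cats0.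
  by apply: eq_in_filter => k; rewrite mem_iota /= add0n nth_cat => ->.
rewrite add0n; apply/eqP; rewrite -[_ == _]negbK -has_filter; apply/hasPn => k.
rewrite mem_iota => /andP[ge_k lt_k]; apply: nc; rewrite ?mem_head //.
by rewrite nth_cat ltnNge ge_k mem_nth // ltn_subLR.
Qed.

Lemma code_map s s' (h : nat -> nat) q : {in q, forall a, s' (h a) = s a} ->
  {in q &, forall a b, (xkey (h a) < xkey (h b)) = (xkey a < xkey b)} ->
  pcode s' (map h q) = pcode s q.
Proof.
elim: q => //= a q IH sh xh; rewrite IH; first last.
- by move=> b c bq cq; apply: xh; rewrite inE ?bq ?cq orbT.
- by move=> b bq; apply: sh; rewrite inE bq orbT.
rewrite sh ?mem_head //; congr ((_, _) :: _); rewrite /crossings size_map.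
apply: eq_in_filter => k; rewrite mem_iota /= add0n => kq.
have kmem : nth 0 q k \in a :: q by rewrite inE mem_nth ?orbT.
by rewrite /cross (nth_map 0) // !sh ?xh ?mem_head.
Qed.

(** These are the positions at which a box sum can be cut. *)
Definition closed_prefix (c : seq (bool * seq nat)) (k : nat) : Prop :=
  forall j o, j < k -> o \in (nth (false, [::]) c j).2 -> j + o.+1 < k.

Lemma closed_code s q : closed_prefix (pcode s q) (size q).
Proof.
move=> j o jq; rewrite nth_code // mem_crossings size_drop => /andP[oq _]; lia.
Qed.

Lemma closed_prefix_cat c d k : k <= size c ->
  closed_prefix (c ++ d) k <-> closed_prefix c k.
Proof.
move=> kc; split=> H j o jk; have jc := leq_trans jk kc.
  by have := H j o jk; rewrite nth_cat jc.
by rewrite nth_cat jc; exact: H.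
Qed.

(** * Codes of runs of consecutive pins *)

Definition side (x : nat -> bool) (i : nat) : bool := x i./2.

(** The pins of a closed prefix are closed under going down and under following crossings upwards,
    and these moves link any two consecutive pins of the run. The excluded run, an up pin and the
    next horizontal pin alone, can fall into two quadrants without any crossing. *)
Lemma run_irreducible (x : nat -> bool) i m k : (m = 2 -> ~~ odd i) ->
  0 < k <= m -> closed_prefix (pcode (side x) (ysort (iota i m))) k -> k = m.
Proof.
move=> im2 /andP[k0 km] clk.
set q := ysort (iota i m) in clk.
have szq : size q = m by rewrite size_ysort size_iota.
have uq : uniq q by rewrite ysort_uniq iota_uniq.
have sq : sorted yltn q by rewrite ysort_sorted ?iota_uniq.
have memq (a : nat) : (a \in q) = (i <= a < i + m) by rewrite mem_ysort mem_iota.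
have idx (a b : nat) : a \in q -> b \in q -> ykey a < ykey b ->
    index a q < index b q.
  move=> aq bq ab; rewrite ltnNge leq_eqVlt; apply/negP => /orP[/eqP|] ba.
    have := nth_index 0 aq; rewrite -ba nth_index // => eab.
    by rewrite eab ltnn in ab.
  have := sorted_ltn_index yltn_trans sq b a bq aq ba.
  by rewrite /yltn /=; lia.
pose P (a : nat) := index a q < k.
have down (a b : nat) : a \in q -> b \in q -> ykey a < ykey b -> P b -> P a.
  by move=> aq bq ab; apply: ltn_trans; exact: idx.
have across (a b : nat) : a \in q -> b \in q -> ykey a < ykey b ->
    cross (side x) a b -> P a -> P b.
  move=> aq bq ab cab Pa; have iab := idx a b aq bq ab.
  have := clk _ (index b q - (index a q).+1) Pa.
  rewrite mem_crossings_pcode ?index_mem // !nth_index // => /(_ cab).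
  by rewrite /P -subSn // subSS subnKC // ltnW.
have up (a : nat) : a \in q -> a.+1 \in q -> P a -> P a.+1.
  move=> aq a1q; case ao : (odd a).
    by apply: down => //; rewrite /ykey /= ao /=; lia.
  apply: across => //; rewrite /ykey /cross /side /xkey /= ao /=; first by lia.
  by rewrite ltnSn andbT; apply/eqP; congr x; lia.
have dn (a : nat) : a \in q -> a.+1 \in q -> P a.+1 -> P a.
  move=> aq a1q; case ao : (odd a); last first.
    by apply: down => //; rewrite /ykey /= ao /=; lia.
  (* Pin [a + 1] lies below the up pin [a]. Either pin [a + 2], above both, is reached from [a + 1]
     by a crossing, or pin [a - 1], below both, belongs to the run and crosses [a]. *)
  move=> Pa1; case a2q : (a.+2 \in q).
    apply: (down _ a.+2) => //; last exact: up.
    by rewrite /ykey /= ao /=; lia.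
  have a0 : 0 < a by case: (a) ao.
  have amq : a.-1 \in q.
    rewrite memq; move: aq a1q a2q; rewrite !memq => aq a1q a2q.
    case: (leqP i a.-1) => [_|ia] /=; first by lia.
    have ei : i = a by lia.
    by have := im2 ltac:(lia); rewrite ei ao.
  rewrite -(prednK a0); apply: up; rewrite ?prednK //.
  apply: (down _ a.+1) => //; rewrite /ykey /= ao /=.
  have -> : odd a.-1 = false by lia.
  by lia.
have [a0 a0q Pa0] : exists2 a : nat, a \in q & P a.
  exists (nth 0 q 0); first by rewrite mem_nth // szq; lia.
  by rewrite /P index_uniq // szq; lia.
have Pup d : a0 + d \in q -> P (a0 + d).
  elim: d => [|d IH]; first by rewrite addn0.
  rewrite addnS => dq; have dq' : a0 + d \in q by move: a0q dq; rewrite !memq; lia.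
  by apply: up => //; exact: IH.
have Pdn d : d <= a0 -> a0 - d \in q -> P (a0 - d).
  elim: d => [|d IH]; first by rewrite subn0.
  move=> da dq; have e : a0 - d = (a0 - d.+1).+1 by lia.
  have dq' : (a0 - d.+1).+1 \in q by move: a0q dq; rewrite !memq; lia.
  by apply: dn => //; rewrite -e; apply: IH; [lia|rewrite e].
have Pall (a : nat) : a \in q -> P a.
  move=> aq; case: (leqP a0 a) => h.
    by rewrite -(subnKC h); apply: Pup; rewrite subnKC.
  have e : a = a0 - (a0 - a) by lia.
  by rewrite e; apply: Pdn; [lia|rewrite -e].
have m0 : 0 < m by lia.
have mq : m.-1 < size q by rewrite szq; lia.
by have := Pall _ (mem_nth 0 mq); rewrite /P index_uniq //; lia.
Qed.

Definition word_factor (x : nat -> bool) (j l : nat) : seq bool :=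
  [seq x k | k <- iota j l].

(* Code of the points of a factor of length [m] of the pin word that starts
   with a horizontal letter if [e = false], with a vertical one if
   [e = true], and reads the letters [v] of the underlying binary word. *)
Definition run_code (m : nat) (e : bool) (v : seq bool) : seq (bool * seq nat) :=
  pcode (side (nth false v)) (ysort (iota e m)).

Lemma size_run_code m e v : size (run_code m e v) = m.
Proof. by rewrite size_code size_ysort size_iota. Qed.

(** Translation by an even number of pins preserves the order of both keys, so only the length, the
    parity of the start and the letters read matter. *)
Lemma code_run (x : nat -> bool) i m :
  pcode (side x) (ysort (iota i m)) =
  run_code m (odd i) (word_factor x i./2 (uphalf (m + odd i))).
Proof.
have ei : i = (i./2).*2 + odd i by lia.
rewrite {1}ei iotaDl ysort_map ?iota_uniq //; last first.
  move=> a b _ _; rewrite /ykey !oddD !odd_double /=.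
  by case: ifP; case: ifP; lia.
apply: code_map => [a|a b _ _]; last first.
  rewrite /xkey !oddD !odd_double /=.
  by case: ifP; case: ifP; lia.
rewrite mem_ysort mem_iota => ha; rewrite /side.
rewrite (nth_map 0) ?size_iota ?nth_iota; try lia.
by congr x; lia.
Qed.

Lemma run_code_eq_parity m (e : bool) v v' : size v = uphalf (m + e) ->
  size v' = uphalf (m + e) -> 0 < m -> run_code m e v = run_code m e v' -> v = v'.
Proof.
move=> sv sv' m0 /(congr1 (map fst)); rewrite !map_fst_code => /eq_in_map h.
apply: (@eq_from_nth _ false); first by rewrite sv.
move=> j; rewrite sv => jl.
(* Pins [2j] and [2j + 1] read letter [j]; the run starts at pin [e], which therefore serves for
   letter 0. *)
have := h (if j == 0 then nat_of_bool e else j.*2).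
rewrite mem_ysort mem_iota /side; case: eqP => [->|] j0.
  by rewrite (_ : e./2 = 0) in j0; [apply: j0; lia|case: (e)].
by rewrite doubleK; apply; lia.
Qed.

Lemma ysort_even_run m : 3 < m ->
  exists q, ysort (iota 0 m) = [:: 0, 2, 1 & q].
Proof.
move=> m3; exists (ysort (iota 3 (m - 3))).
have -> : iota 0 m = [:: 0; 1; 2] ++ iota 3 (m - 3).
  by rewrite -(iotaD 0 3) subnKC // ltnW.
rewrite ysort_cat ?iota_uniq // => a b; rewrite mem_iota !inE => h1 h2.
by rewrite /ykey; case: ifP; case: ifP; lia.
Qed.

Lemma ysort_odd_run m : 3 < m ->
  exists q, ysort (iota 1 m) = [:: 2, 1, 4, 3 & q].
Proof.
move=> m3; exists (ysort (iota 5 (m - 4))).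
have -> : iota 1 m = [:: 1; 2; 3; 4] ++ iota 5 (m - 4).
  by rewrite -(iotaD 1 4) subnKC.
rewrite ysort_cat ?iota_uniq // => a b; rewrite mem_iota !inE => h1 h2.
by rewrite /ykey; case: ifP; case: ifP; lia.
Qed.

(* The lowest and the third lowest point cross exactly in the runs that start
   with a horizontal letter. *)
Lemma run_code_parity m v v' : 3 < m ->
  run_code m false v <> run_code m true v'.
Proof.
move=> m3; rewrite /run_code /=.
have [q ->] := ysort_even_run m3; have [q' ->] := ysort_odd_run m3.
move=> /= [_ h _]; have : 1 \in crossings (side (nth false v)) 0 [:: 2, 1 & q].
  by rewrite mem_crossings /= /cross /side /= eqxx.
by rewrite h mem_crossings /= /cross /= andbF.
Qed.

End Codes.

(** * Splitting index sets into runs *)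

Lemma sorted_run_split (S : seq nat) : sorted ltn S -> S != [::] ->
  exists i m S', [/\ S = iota i m.+1 ++ S', sorted ltn S' &
                     all (ltn (i + m.+1)) S'].
Proof.
elim: S => // a S IH; case: (eqVneq S [::]) => [-> _ _|Sn0].
  by exists a, 0, [::].
rewrite [X in X -> _]/= path_sortedE; last exact: ltn_trans.
move=> /andP[aS sS] _; have [i [m [S' [eS sS' ltS']]]] := IH sS Sn0.
case: (eqVneq i a.+1) => [ei|ni].
  exists a, m.+1, S'; rewrite eS ei; split => //.
  by apply: sub_all ltS' => b; rewrite /= ei; lia.
exists a, 0, S; split => //.
have ai : a < i by apply: (allP aS); rewrite eS mem_head.
apply/allP => b; rewrite eS mem_cat => /orP[|/(allP ltS')] /=.
  by rewrite -[i :: _]/(iota i m.+1) mem_iota; lia.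
by lia.
Qed.

(** With a missing index in between, the swaps of consecutive pins cannot interfere: the pins of
    [S2] lie above those of [S1] and have larger [xkey]. *)
Lemma code_box_sum (x : nat -> bool) S1 S2 : uniq S1 -> uniq S2 ->
  (forall a b, a \in S1 -> b \in S2 -> a.+1 < b) ->
  pcode (side x) (ysort (S1 ++ S2)) =
  pcode (side x) (ysort S1) ++ pcode (side x) (ysort S2).
Proof.
move=> u1 u2 lt12; rewrite ysort_cat //; last first.
  move=> a b /lt12 h /h; rewrite /ykey.
  by case: ifP; case: ifP; lia.
apply: code_cat => a b; rewrite !mem_ysort => /lt12 h /h.
rewrite /cross /xkey negb_and; case: eqP => //= _.
by case: ifP; case: ifP; lia.
Qed.

(** * Canonical types of runs and the prefix property *)

Section CanonicalRuns.
Variable fac : nat -> seq (seq bool).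
Hypothesis fac_uniq : forall l, uniq (fac l).
Hypothesis size_fac : forall l, size (fac l) = l.+1.
Hypothesis fac_size : forall l v, v \in fac l -> size v = l.

Definition run_type : Type := (nat * bool * seq bool)%type.
Definition run_len (t : run_type) : nat := t.1.1.
Definition type_code (t : run_type) := run_code t.1.1 t.1.2 t.2.

(* One representative for each box-indecomposable point set that is given by
   a factor of the pin word: the two parities give the same sets in length 1,
   the same indecomposable ones in length 2, and the same sets spread over
   both quadrants in length 3. *)
Definition types_of_len (m : nat) : seq run_type :=
  match m with
  | 0 => [::]
  | 1 | 2 => [seq (m, false, v) | v <- fac 1]
  | 3 => (3, true, [:: false; false]) :: [seq (3, false, v) | v <- fac 2]
  | _ => [seq (m, false, v) | v <- fac (uphalf m)] ++
         [seq (m, true, v) | v <- fac (uphalf m.+1)]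
  end.

(** For [m >= 4] the two parities contribute [uphalf m + 1] and [uphalf m.+1 + 1] factors. *)
Definition num_types (m : nat) : nat :=
  match m with 0 => 0 | 1 | 2 => 2 | 3 => 4 | _ => m + 3 end.

Lemma size_types_of_len m : size (types_of_len m) = num_types m.
Proof.
case: m => [|[|[|[|m]]]] //=; rewrite ?size_cat !size_map !size_fac //.
rewrite /=; lia.
Qed.

Lemma types_of_len_uniq m : uniq (types_of_len m).
Proof.
have inj m' e : injective (fun v => (m', e, v) : run_type) by move=> v v' [].
case: m => [|[|[|[|m]]]] //; try by rewrite map_inj_uniq.
  by rewrite /= map_inj_uniq ?fac_uniq ?andbT //; apply/mapP => -[].
rewrite cat_uniq !map_inj_uniq ?fac_uniq //= andbT; apply/hasPn => t.
by case/mapP => v _ ->; apply/mapP => -[].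
Qed.

Variant type_spec m : run_type -> Prop :=
  | TypeShort v : 0 < m < 3 -> v \in fac 1 -> type_spec m (m, false, v)
  | Type3 v : m = 3 -> v \in fac 2 -> type_spec m (m, false, v)
  | Type3Odd : m = 3 -> type_spec m (m, true, [:: false; false])
  | TypeLong (e : bool) v : 3 < m -> v \in fac (uphalf (m + e)) ->
      type_spec m (m, e, v).

Lemma types_of_lenP m t : reflect (type_spec m t) (t \in types_of_len m).
Proof.
apply: (iffP idP).
  case: m => [|[|[|[|m]]]] //.
  - by case/mapP => v vf ->; exact: TypeShort.
  - by case/mapP => v vf ->; exact: TypeShort.
  - rewrite inE => /predU1P[->|/mapP[v vf ->]]; first exact: Type3Odd.
    exact: Type3.
  - rewrite mem_cat => /orP[] /mapP[v vf ->]; apply: TypeLong => //.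
      by rewrite addn0.
    by rewrite addn1.
case=> [v m3 vf|v -> vf|->|e v m3 vf].
- by case: m m3 => [|[|[|m]]] // _; apply: map_f.
- by rewrite inE map_f ?orbT.
- exact: mem_head.
- case: m m3 vf => [|[|[|[|m]]]] // _; case: e => vf; rewrite mem_cat.
    by rewrite orbC map_f //; move: vf; rewrite addn1.
  by rewrite map_f //; move: vf; rewrite addn0.
Qed.

Lemma run_len_type m t : t \in types_of_len m -> run_len t = m.
Proof. by move/types_of_lenP; case. Qed.

Lemma size_type_code t : size (type_code t) = run_len t.
Proof. exact: size_run_code. Qed.

Lemma type_code_irreducible m t k : t \in types_of_len m ->
  0 < k <= m -> closed_prefix (type_code t) k -> k = m.
Proof.
move=> tm km; have tm' := types_of_lenP _ _ tm.
have -> : type_code t = run_code m t.1.2 t.2.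
  by rewrite /type_code -/(run_len t) (run_len_type tm).
apply: run_irreducible => // m2; move: tm'; rewrite m2.
by case=> [v _ _|v|//|e v].
Qed.

Lemma type_code_inj m : {in types_of_len m &, injective type_code}.
Proof.
have inj (e : bool) (v v' : seq bool) : 0 < m ->
    size v = uphalf (m + e) -> size v' = uphalf (m + e) ->
    type_code (m, e, v) = type_code (m, e, v') ->
    (m, e, v) = (m, e, v') :> run_type.
  by move=> m0 sv sv' h; congr (_, _, _); apply: run_code_eq_parity h.
move=> t t' /types_of_lenP tm /types_of_lenP tm'.
case: tm => [v m3 vf|v m3 vf|m3|e v m3 vf];
  case: tm' => [v' m3' vf'|v' m3' vf'|m3'|e' v' m3' vf']; try lia.
- by apply: inj; rewrite ?(fac_size vf) ?(fac_size vf'); lia.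
- by apply: inj; rewrite ?(fac_size vf) ?(fac_size vf') m3.
- move: vf; rewrite m3 => vf; have := fac_size vf.
  by case: v {vf} => [|[] [|[] [|]]].
- move: vf'; rewrite m3 => vf; have := fac_size vf.
  by case: v' {vf} => [|[] [|[] [|]]].
- by [].
- case: e vf; case: e' vf' => vf' vf.
  + by apply: inj; rewrite ?(fac_size vf) ?(fac_size vf'); lia.
  + by move/esym/run_code_parity => /(_ m3).
  + by move/run_code_parity => /(_ m3).
  + by apply: inj; rewrite ?(fac_size vf) ?(fac_size vf'); lia.
Qed.

(* A closed proper prefix of an indecomposable code does not exist, hence the
   codes of the canonical types form a prefix code. *)
Lemma type_code_prefix m m' t t' c c' :
  t \in types_of_len m -> t' \in types_of_len m' ->
  type_code t ++ c = type_code t' ++ c' -> t = t' /\ c = c'.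
Proof.
wlog mm : m m' t t' c c' / m <= m' => [H|].
  move=> tm tm' e; case/orP: (leq_total m m') => h.
    exact: (H _ _ _ _ _ _ h tm tm' e).
  by have [-> ->] := H _ _ _ _ _ _ h tm' tm (esym e).
move=> tm tm' e.
have st : size (type_code t) = m by rewrite size_type_code (run_len_type tm).
have st' : size (type_code t') = m' by rewrite size_type_code (run_len_type tm').
have m0 : 0 < m by move: (types_of_lenP _ _ tm); case=> *; lia.
(* The shorter code has no crossing beyond its own end, so it cuts the longer one at position
   [m]. *)
have cl : closed_prefix (type_code t') m.
  rewrite -(closed_prefix_cat c') ?st' // -e closed_prefix_cat ?st // -st.
  by rewrite /type_code /run_code size_code; exact: closed_code.
have em := type_code_irreducible tm' (introT andP (conj m0 mm)) cl.
move/eqP: e; rewrite eqseq_cat ?st ?st' // => /andP[/eqP e /eqP ->].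
by split=> //; apply: (type_code_inj (m := m)) => //; rewrite em.
Qed.

(** * Enumeration of box sums by length *)

Inductive box_sum_code : nat -> seq (bool * seq nat) -> Prop :=
  | BoxSumNil : box_sum_code 0 [::]
  | BoxSumCons m t n c : t \in types_of_len m -> box_sum_code n c ->
      box_sum_code (m + n) (type_code t ++ c).

Definition types_upto (n : nat) : seq run_type :=
  flatten [seq types_of_len m | m <- iota 1 n].

Lemma types_upto_uniq n : uniq (types_upto n).
Proof.
rewrite /types_upto; elim: n => // n IH.
rewrite -[n.+1]addn1 iotaD map_cat flatten_cat.
rewrite (_ : flatten (map _ (iota (1 + n) 1)) = types_of_len n.+1); last first.
  exact: cats0.
rewrite cat_uniq IH types_of_len_uniq andbT; apply/hasPn => t tn.
apply/negP => /flattenP[_ /mapP[m + ->] tm].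
by rewrite mem_iota -(run_len_type tm) (run_len_type tn); lia.
Qed.

Lemma mem_types_upto n t :
  (t \in types_upto n) = (t \in types_of_len (run_len t)) && (run_len t <= n).
Proof.
apply/flattenP/andP => [[_ /mapP[m + ->] tm]|[tt tn]].
  by rewrite mem_iota (run_len_type tm) tm => ?; split=> //; lia.
exists (types_of_len (run_len t)) => //; apply: map_f; rewrite mem_iota.
by case: (run_len t) tt tn.
Qed.

(** All lengths up to [n] are tabulated, since removing the first summand can leave a remainder of
    any smaller length. *)
Fixpoint code_table (n : nat) : seq (seq (seq (bool * seq nat))) :=
  if n is n'.+1 then
    rcons (code_table n')
      [seq type_code t ++ c | t <- types_upto n,
                              c <- nth [::] (code_table n') (n - run_len t)]
  else [:: [:: [::]]].

Definition codes_of_len (n : nat) := nth [::] (code_table n) n.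

Lemma size_code_table n : size (code_table n) = n.+1.
Proof. by elim: n => //= n IH; rewrite size_rcons IH. Qed.

Lemma nth_code_table n k : k <= n -> nth [::] (code_table n) k = codes_of_len k.
Proof.
elim: n => [|n IH]; first by case: k.
rewrite leq_eqVlt => /predU1P[->//|kn].
by rewrite /= nth_rcons size_code_table kn IH.
Qed.

Lemma codes_of_lenS n : codes_of_len n.+1 =
  [seq type_code t ++ c | t <- types_upto n.+1,
                          c <- codes_of_len (n.+1 - run_len t)].
Proof.
rewrite {1}/codes_of_len /= nth_rcons size_code_table ltnn eqxx.
congr flatten; apply/eq_in_map => t; rewrite mem_types_upto => /andP[tt tn].
rewrite nth_code_table //; case: (run_len t) tt tn => // m; lia.
Qed.

Lemma mem_codes_of_len n c : c \in codes_of_len n <-> box_sum_code n c.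
Proof.
elim/ltn_ind: n c => -[|n] IH c.
  rewrite inE; split=> [/eqP ->|]; first exact: BoxSumNil.
  move En: 0 => n h; case: h En => // m t k d tm _ e.
  by case: m tm e.
rewrite codes_of_lenS; split.
  case/allpairsPdep => t [d [+ dn ->]]; rewrite mem_types_upto => /andP[tt tn].
  rewrite -(subnKC tn); apply: BoxSumCons => //; apply/IH => //.
  by case: (run_len t) tt => // m _; lia.
move En: n.+1 => n' h; case: h En => // m t k d tm dk e.
have tl := run_len_type tm; have m0 : 0 < m by case: (m) tm.
apply/allpairsPdep; exists t, d; split => //.
  by rewrite mem_types_upto tl tm leq_addr.
by rewrite tl addKn; apply/IH => //; lia.
Qed.

(** By the prefix property the first summand and the remainder can be read off a code: the canonical
    types generate freely. *)
Lemma codes_of_len_uniq n : uniq (codes_of_len n).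
Proof.
elim/ltn_ind: n => -[|n] IH //; rewrite codes_of_lenS.
apply: allpairs_uniq_dep; first exact: types_upto_uniq.
  move=> t; rewrite mem_types_upto => /andP[tt tn]; apply: IH.
  by case: (run_len t) tt tn => // m; lia.
move=> _ _ /allpairsPdep[t [c [+ _ ->]]] /allpairsPdep[t' [c' [+ _ ->]]] /=.
rewrite !mem_types_upto => /andP[tt _] /andP[tt' _] e.
by have [-> ->] := type_code_prefix tt tt' e.
Qed.

(** Sorting the codes by the length [m + 1] of the first summand gives the renewal equation. *)
Lemma size_codes_of_len n : size (codes_of_len n.+1) =
  \sum_(m < n.+1) num_types m.+1 * size (codes_of_len (n - m)).
Proof.
rewrite codes_of_lenS size_allpairs_dep sumnE big_map /types_upto.
rewrite big_flatten big_map -[iota 1 _]/(iota (1 + 0) _) iotaDl big_map.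
rewrite -[X in iota _ X]subn0 -/(index_iota 0 n.+1) big_mkord.
apply: eq_bigr => m _; rewrite big_seq.
rewrite (eq_bigr (fun=> size (codes_of_len (n - m)))).
  by rewrite -big_seq big_const_seq count_predT iter_addn addn0 mulnC
     size_types_of_len.
by move=> t /run_len_type ->; rewrite subSS.
Qed.

Hypothesis fac11 : [:: true; true] \notin fac 2.

(** Pigeonhole: two distinct words among the two of length 1. The same count gives [mem_fac2], where
    the absence of [11] leaves three candidates. *)
Lemma mem_fac1 b : [:: b] \in fac 1.
Proof.
have sub : {subset fac 1 <= [:: [:: false]; [:: true]]}.
  by move=> v /fac_size; case: v => [|[] [|]].
by have [_ ->] := uniq_min_size (fac_uniq 1) sub ltac:(by rewrite size_fac);
   case: b.
Qed.

Lemma mem_fac2 b c : ([:: b; c] \in fac 2) = ~~ (b && c).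
Proof.
have sub : {subset fac 2 <= [:: [:: false; false]; [:: false; true];
                                [:: true; false]]}.
  move=> v v2; have := fac_size v2; move: v2.
  by case: v => [|[] [|[] [|]]] //=; rewrite (negPf fac11).
by have [_ ->] := uniq_min_size (fac_uniq 2) sub ltac:(by rewrite size_fac);
   case: b; case: c.
Qed.

(** * Box sums as the codes of sets of pins *)

Section Occurrences.
Variable x : nat -> bool.
Hypothesis fac_factor : forall j l, word_factor x j l \in fac l.
Hypothesis fac_recurrent : forall N l v, v \in fac l ->
  exists2 j, N <= j & word_factor x j l = v.

(** Runs of length at most 3 that start with an up pin may have to be rewritten into canonical
    types; all other runs are canonical as they stand. *)
Lemma run_box_sum i m n c : box_sum_code n c ->
  box_sum_code (m.+1 + n) (pcode (side x) (ysort (iota i m.+1)) ++ c).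
Proof.
move=> cn; rewrite code_run.
have := fac_factor i./2 (uphalf (m.+1 + odd i)).
set v := word_factor _ _ _; case: (odd i) v => v.
  case: m => [|[|[|m]]] vf.
  - have := fac_size vf; case: v {vf} => [|b []] // _.
    rewrite -[run_code _ _ _]/(type_code (1, false, [:: b])).
    by apply: BoxSumCons cn; apply/types_of_lenP/TypeShort => //; exact: mem_fac1.
  - have := fac_size vf; case: v {vf} => [|b [|d []]] // _.
    have [<-|bd] := eqVneq b d.
      rewrite (_ : run_code _ _ _ = type_code (2, false, [:: b])); last first.
        by case: (b).
      apply: BoxSumCons cn; apply/types_of_lenP/TypeShort => //.
      exact: mem_fac1.
    (* In different quadrants the two pins do not cross; the later pin is the lower one and comes
       first. *)
    rewrite (_ : run_code _ _ _ = type_code (1, false, [:: d]) ++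
                                  type_code (1, false, [:: b])); last first.
      by case: (b) (d) bd => -[].
    rewrite -catA -[2 + n]/(1 + (1 + n)).
    by do !apply: BoxSumCons => //; apply/types_of_lenP/TypeShort => //;
       exact: mem_fac1.
  - have := fac_size vf; case: v vf => [|b [|d []]] // vf _.
    have [ebd|bd] := eqVneq b d.
      apply: (BoxSumCons (t := (3, true, [:: b; d]))) cn.
      (* As [11] is no factor, equal letters are both [false]. *)
      apply/types_of_lenP; move: vf; rewrite -ebd mem_fac2 andbb => /negPf ->.
      exact: Type3Odd.
    (* In both runs a lone point of one quadrant has its height between those of two crossing points
       of the other. *)
    rewrite (_ : run_code _ _ _ = type_code (3, false, [:: d; b])); last first.
      by case: (b) (d) bd => -[].
    apply: BoxSumCons cn; apply/types_of_lenP/Type3 => //.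
    by rewrite mem_fac2 andbC -mem_fac2.
  - by apply: (BoxSumCons (t := (m.+4, true, v))) cn; apply/types_of_lenP/TypeLong.
move=> vf; apply: (BoxSumCons (t := (m.+1, false, v))) cn; apply/types_of_lenP.
case: m v vf => [|[|[|m]]] v vf.
- exact: TypeShort.
- exact: TypeShort.
- exact: Type3.
- exact: TypeLong.
Qed.

Lemma code_box_sum_code (S : seq nat) : uniq S ->
  box_sum_code (size S) (pcode (side x) (ysort S)).
Proof.
move: {2}(size S).+1 (ltnSn (size S)) => k; elim: k S => // k IH S Sk uS.
pose S' := sort leq S.
have eS : ysort S' = ysort S.
  by apply: eq_ysort; rewrite ?sort_uniq ?ysort_sorted // => a;
     rewrite mem_ysort mem_sort.
rewrite -eS -(size_sort leq S) -/S'.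
have sS' : sorted ltn S'.
  by rewrite ltn_sorted_uniq_leq sort_uniq uS; exact: (sort_sorted leq_total).
case: (eqVneq S' [::]) => [->|Sn0]; first exact: BoxSumNil.
have [i [m [S1 [e sS1 ltS1]]]] := sorted_run_split sS' Sn0.
have uS1 : uniq S1 by move: sS1; rewrite ltn_sorted_uniq_leq => /andP[].
rewrite e size_cat size_iota code_box_sum ?iota_uniq //.
  apply: run_box_sum; apply: IH => //.
  have := congr1 size e; rewrite size_sort size_cat size_iota => h.
  by move: Sk; rewrite h ltnS; apply: leq_trans; rewrite addSn ltnS leq_addl.
by move=> a b; rewrite mem_iota => ha /(allP ltS1) /=; lia.
Qed.

(** Recurrence lets the runs of successive summands be chosen one after another, each beyond the
    previous ones. *)
Lemma box_sum_code_realised n c N : box_sum_code n c ->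
  exists S, [/\ uniq S, size S = n, all (leq N) S &
                pcode (side x) (ysort S) = c].
Proof.
move=> cn; elim: cn N => [|m t {}n {}c tm _ IH] N; first by exists [::].
have [i [Ni ei]] : exists i, N <= i /\
    pcode (side x) (ysort (iota i m)) = type_code t.
  have : exists (e : bool) v, t = (m, e, v) /\ v \in fac (uphalf (m + e)).
    case/types_of_lenP: tm => [v m3 vf|v m3 vf|m3|e v m3 vf].
    - by exists false, v; case: m m3 => [|[|[|]]].
    - by exists false, v; rewrite m3.
    - by exists true, [:: false; false]; rewrite m3 mem_fac2.
    - by exists e, v.
  case=> e [v [-> vf]]; have [j Nj ej] := fac_recurrent N vf.
  (* This pin has parity [e] and reads letter [j]. *)
  exists (j.*2 + e); split; first by lia.
  rewrite code_run /type_code /= oddD odd_double oddb /=.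
  by rewrite (_ : (j.*2 + e)./2 = j) ?ej //; case: (e); lia.
(* Index [i + m] is skipped, so that the run stays separated from the later pins. *)
have [S [uS szS NS cS]] := IH (i + m).+1.
exists (iota i m ++ S).
have lt12 a b : a \in iota i m -> b \in S -> a.+1 < b.
  by rewrite mem_iota => ha /(allP NS); lia.
split.
- rewrite cat_uniq iota_uniq uS andbT /=; apply/hasPn => b bS; apply/negP => bi.
  by have := lt12 b b bi bS; lia.
- by rewrite size_cat size_iota szS.
- rewrite all_cat; apply/andP; split; apply/allP => a.
    by rewrite mem_iota; lia.
  by move/(allP NS); lia.
- by rewrite code_box_sum ?iota_uniq // ei cS.
Qed.

End Occurrences.
End CanonicalRuns.

Local Open Scope classical_set_scope.
Local Open Scope ring_scope.

(** * The renewal equation *)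

Section Growth.
Variable R : realType.
Implicit Types (x y mu : R).

Lemma horner_mu_poly x :
  (mu_poly R).[x] = x ^+ 5 - 4 * x ^+ 4 + 3 * x ^+ 3 - 2 * x ^+ 2 - x + 2.
Proof. by rewrite /mu_poly !hornerE /= ?hornerXn. Qed.

(* All derivatives of the polynomial are positive at 328/100. *)
Lemma mu_poly_increasing x y :
  328 / 100 <= x -> x < y -> (mu_poly R).[x] < (mu_poly R).[y].
Proof.
move=> hx xy; rewrite !horner_mu_poly.
pose s := x - 328 / 100; pose t := y - 328 / 100.
have [s0 st] : 0 <= s /\ s < t by rewrite /s /t; lra.
have t0 : 0 <= t by lra.
have -> : x = 328 / 100 + s by rewrite /s; ring.
have -> : y = 328 / 100 + t by rewrite /t; ring.
have h n : s ^+ n <= t ^+ n by rewrite lerXn2r // ltW.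
have := h 2%N; have := h 3%N; have := h 4%N; have := h 5%N.
rewrite -subr_gt0.
set a2 := s ^+ 2; set b2 := t ^+ 2; set a3 := s ^+ 3; set b3 := t ^+ 3.
set a4 := s ^+ 4; set b4 := t ^+ 4; set a5 := s ^+ 5; set b5 := t ^+ 5.
move=> h5 h4 h3 h2.
(* Difference of the Taylor expansions at [328 / 100]; the coefficient [124 / 10] is
   [5 * (328 / 100) - 4]. *)
have -> : (328 / 100 + t) ^+ 5 - 4 * (328 / 100 + t) ^+ 4 +
    3 * (328 / 100 + t) ^+ 3 - 2 * (328 / 100 + t) ^+ 2 - (328 / 100 + t) + 2 -
    ((328 / 100 + s) ^+ 5 - 4 * (328 / 100 + s) ^+ 4 +
    3 * (328 / 100 + s) ^+ 3 - 2 * (328 / 100 + s) ^+ 2 - (328 / 100 + s) + 2)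
  = (b5 - a5) + 124 / 10 * (b4 - a4) + (10 * (328 / 100) ^+ 2 -
      16 * (328 / 100) + 3) * (b3 - a3)
    + (10 * (328 / 100) ^+ 3 - 24 * (328 / 100) ^+ 2 + 9 * (328 / 100) - 2)
      * (b2 - a2)
    + (5 * (328 / 100) ^+ 4 - 16 * (328 / 100) ^+ 3 + 9 * (328 / 100) ^+ 2
       - 4 * (328 / 100) - 1) * (t - s).
  by rewrite /a2 /b2 /a3 /b3 /a4 /b4 /a5 /b5; field.
by lra.
Qed.

Lemma exists_mu : exists mu : R, [/\ largest_root (mu_poly R) mu,
  `|mu - (328 / 10 ^+ 2 + 277 / 10 ^+ 5)| < 5 / 10 ^+ 6 &
  328 / 100 < mu < 4].
Proof.
(* The half-width [4 / 10 ^+ 6] stays below the allowed error [5 / 10 ^+ 6], and the polynomial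
   changes sign between [a] and [b]. *)
pose a : R := 328 / 100 + 277 / 10 ^+ 5 - 4 / 10 ^+ 6.
pose b : R := 328 / 100 + 277 / 10 ^+ 5 + 4 / 10 ^+ 6.
have ab : a <= b by rewrite /a /b; lra.
have fa : (mu_poly R).[a] < 0 by rewrite horner_mu_poly /a; lra.
have fb : 0 < (mu_poly R).[b] by rewrite horner_mu_poly /b; lra.
have [|mu /andP[amu mub] mu0] := @poly_ivt R (mu_poly R) a b ab.
  by rewrite ltW // ltW.
rewrite /a in amu; rewrite /b in mub.
exists mu; split; last by apply/andP; split; lra.
  split=> // y y0; case: (lerP y mu) => // muy.
  have := @mu_poly_increasing mu y ltac:(lra) muy.
  by rewrite (rootP mu0) (rootP y0) ltxx.
by rewrite ltr_norml; apply/andP; split; lra.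
Qed.

Lemma sum_geometric_linear n :
  \sum_(j < n) (j%:R + 4) * (1 / 2) ^+ j = 10 - (2 * n%:R + 10) * (1 / 2) ^+ n
    :> R.
Proof.
elim: n => [|n IH]; first by rewrite big_ord0 expr0; lra.
by rewrite big_ord_recr /= IH exprS -natr1; field.
Qed.

(** * Bounds on the renewal sequence *)

Section Renewal.
Variables (mu : R) (f : nat -> nat).
Hypothesis mu_root : root (mu_poly R) mu.
Hypothesis mu_gt : 328 / 100 < mu.
Hypothesis mu_lt : mu < 4.
Hypothesis f0 : f 0%N = 1%N.
Hypothesis fS : forall n, f n.+1 = (\sum_(m < n.+1) num_types m.+1 * f (n - m))%N.

Let z := mu^-1.

(** The weights [p m] form a probability distribution on the lengths, with tails [tail n]; [g] is
    the normalised count. *)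
Let p (m : nat) : R := (num_types m)%:R * z ^+ m.
Let tail (n : nat) : R := 1 - \sum_(m < n) p m.+1.
Let g (n : nat) : R := (f n)%:R * z ^+ n.

Let mu0 : 0 < mu. Proof. by have := mu_gt; lra. Qed.
Let z0 : 0 < z. Proof. by rewrite invr_gt0. Qed.
Let zlt : z < 1 / 3.
Proof.
have h := mu_gt; have h' := mu0.
by rewrite div1r /z ltf_pV2 ?posrE; lra.
Qed.

Let zgt : 1 / 4 < z.
Proof.
have h := mu_lt; have h' := mu0.
by rewrite div1r /z ltf_pV2 ?posrE; lra.
Qed.

Let z_root : 1 - 4 * z + 3 * z ^+ 2 - 2 * z ^+ 3 - z ^+ 4 + 2 * z ^+ 5 = 0.
Proof.
have /rootP := mu_root; rewrite horner_mu_poly => e.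
apply: (mulfI (lt0r_neq0 (exprn_gt0 5 mu0))); rewrite mulr0 -{}e /z.
by field; rewrite lt0r_neq0.
Qed.

(** The right side is the value of the series of [(m + 3) * z ^+ m] over [m >= n + 4]. At [n = 0]
    the formula is the characteristic equation [z_root] divided by [(1 - z) ^+ 2]; the induction
    then removes one term at a time. *)
Let tailE n : tail n.+3 = z ^+ n.+4 * ((n%:R + 7) - (n%:R + 6) * z) / (1 - z) ^+ 2.
Proof.
have h := zlt; have z1 : 1 - z != 0 by rewrite subr_eq0 eq_sym lt_eqF //; lra.
elim: n => [|n IH].
  apply: (mulIf (expf_neq0 2 z1)); rewrite divfK ?expf_neq0 //.
  rewrite /tail !big_ord_recr big_ord0 /= /p /= !expr1.
  by apply/eqP; rewrite -subr_eq0 -[X in _ == X]z_root; apply/eqP; ring.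
rewrite /tail big_ord_recr opprD addrA -/(tail n.+3) IH /p /=.
by rewrite !natrD -!natr1 !exprS; field.
Qed.

Let tail_ge0 n : 0 <= tail n.+3.
Proof.
have hz := zlt; have hz0 := z0; have hz1 := zgt.
rewrite tailE; apply: divr_ge0; last exact: sqr_ge0.
apply: mulr_ge0; first by rewrite exprn_ge0 // ltW.
have : 0 <= n%:R :> R by [].
by nra.
Qed.

Let tail_le n : tail n <= 3 * ((n%:R + 4) * z ^+ n).
Proof.
have hz := zlt; have hz0 := z0; have hz1 := zgt.
case: n => [|[|[|n]]].
- by rewrite /tail big_ord0; lra.
- by rewrite /tail big_ord1 /p /=; lra.
- by rewrite /tail !big_ord_recr big_ord0 /p /= expr1; nra.
rewrite tailE ler_pdivrMr; last by rewrite exprn_gt0 //; lra.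
have zn : 0 < z ^+ n.+3 by rewrite exprn_gt0.
have n0 : 0 <= n%:R :> R by [].
rewrite exprS -[in n.+3%:R]addn3 natrD; set Z := z ^+ n.+3 in zn *.
have -> : 3 * ((n%:R + 3 + 4) * Z) * (1 - z) ^+ 2 =
  Z * (3 * (n%:R + 7) * (1 - z) ^+ 2) by ring.
rewrite [z * Z]mulrC -[X in X <= _]mulrA ler_pM2l //.
have h : 4 / 9 <= (1 - z) ^+ 2 by nra.
apply: (@le_trans _ _ ((n%:R + 7) * (1 / 3))); first by nra.
by nra.
Qed.

Let g_ge0 n : 0 <= g n.
Proof. by rewrite mulr_ge0 // exprn_ge0 // ltW. Qed.

Let gS n : g n.+1 = \sum_(m < n.+1) p m.+1 * g (n - m).
Proof.
rewrite /g fS natr_sum mulr_suml; apply: eq_bigr => m _.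
rewrite natrM /p mulrACA -exprD addSn subnKC //.
by rewrite -ltnS.
Qed.

(** A conservation law: after expanding [g n.+1] by [gS], the identity [p k.+1 + tail k.+1 = tail k]
    turns the sum for [n + 1] into that for [n]. *)
Let renewal n : \sum_(k < n.+1) tail k * g (n - k) = 1.
Proof.
elim: n => [|n IH].
  by rewrite big_ord1 /tail big_ord0 subr0 mul1r /g f0 expr0 mulr1.
rewrite big_ord_recl {1}/tail big_ord0 subr0 mul1r subn0 gS -[RHS]IH.
rewrite -big_split; apply: eq_bigr => k _ /=; rewrite /bump /= add1n subSS.
by rewrite -mulrDl /tail big_ord_recr /=; congr (_ * _); ring.
Qed.

(** Only first summands of length 1 are kept, of which there are two types. *)
Let g_step n : 2 * z * g n <= g n.+1.
Proof.
rewrite gS big_ord_recl subn0 {1}/p /= expr1 lerDl.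
by apply: sumr_ge0 => m _; rewrite mulr_ge0 // mulr_ge0 // exprn_ge0 // ltW.
Qed.

Let g_back n k : (k <= n)%N -> (2 * z) ^+ k * g (n - k) <= g n.
Proof.
elim: k => [|k IH] kn; first by rewrite subn0 expr0 mul1r.
apply: le_trans (IH (ltnW kn)); rewrite exprSr -mulrA ler_wpM2l //.
  by rewrite exprn_ge0 // mulr_ge0 // ltW.
by have := g_step (n - k.+1); rewrite subnSK.
Qed.

Let tail_ge0_all n : 0 <= tail n.
Proof.
have hz := zlt; have hz0 := z0; have hz1 := zgt.
case: n => [|[|[|n]]]; last exact: tail_ge0.
- by rewrite /tail big_ord0; lra.
- by rewrite /tail big_ord1 /p /= expr1; lra.
- by rewrite /tail !big_ord_recr big_ord0 /p /= expr1; nra.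
Qed.

(** The weights [p] have partial sums at most 1, so the recursion preserves the bound. *)
Let g_le1 n : g n <= 1.
Proof.
elim/ltn_ind: n => -[|n] IH; first by rewrite /g f0 expr0 mulr1.
rewrite gS; apply: (@le_trans _ _ (\sum_(m < n.+1) p m.+1)).
  apply: ler_sum => m _; rewrite ler_piMr //.
    by rewrite mulr_ge0 // exprn_ge0 // ltW.
  by apply: IH; rewrite ltnS leq_subr.
by have := tail_ge0_all n.+1; rewrite subr_ge0.
Qed.

(** In the conservation law [tail_le] bounds the weights and [g_back] compares [g (n - k)] with
    [g n]. Splitting [z ^+ k] into [(1 / 2) ^+ k * (2 * z) ^+ k] leaves a sum below 10, hence
    [1 <= 3 * 10 * g n]. *)
Let g_ge n : 30^-1 <= g n.
Proof.
rewrite -[leLHS]mul1r ler_pdivrMr //.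
apply: (@le_trans _ _ (\sum_(k < n.+1) tail k * g (n - k))).
  by rewrite renewal.
apply: (@le_trans _ _ (\sum_(k < n.+1) 3 * ((k%:R + 4) * (1 / 2) ^+ k) * g n)).
  apply: ler_sum => k _.
  apply: (@le_trans _ _ (3 * ((k%:R + 4) * z ^+ k) * g (n - k))).
    by rewrite ler_wpM2r.
  have -> : z ^+ k = (1 / 2) ^+ k * (2 * z) ^+ k.
    by rewrite -exprMn; congr (_ ^+ _); field.
  have -> : 3 * ((k%:R + 4) * ((1 / 2) ^+ k * (2 * z) ^+ k)) * g (n - k) =
    3 * ((k%:R + 4) * (1 / 2) ^+ k) * ((2 * z) ^+ k * g (n - k)) by ring.
  apply: ler_wpM2l; first by rewrite !mulr_ge0 // ?exprn_ge0 // addr_ge0.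
  by apply: g_back; rewrite -ltnS.
rewrite -mulr_suml -mulr_sumr sum_geometric_linear [leRHS]mulrC.
apply: ler_wpM2r => //.
have : 0 <= (2 * n.+1%:R + 10) * (1 / 2) ^+ n.+1 :> R.
  by rewrite mulr_ge0 // exprn_ge0.
by lra.
Qed.

Lemma renewal_growth : (fun n => (f n)%:R `^ n%:R^-1) @ \oo --> mu.
Proof.
(* After the shift the exponent is never the inverse of 0. *)
rewrite -cvg_shiftS.
have fE n : (f n)%:R = mu ^+ n * g n.
  by rewrite /g mulrCA -exprMn mulfV ?expr1n ?mulr1 // lt0r_neq0.
have rootE n : (mu ^+ n.+1) `^ n.+1%:R^-1 = mu.
  rewrite -powR_mulrn ?ltW // -powRrM mulfV ?powRr1 ?ltW //.
have lim : (fun n => mu * (30^-1) `^ n.+1%:R^-1) @ \oo --> mu.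
  rewrite -[X in _ --> X]mulr1; apply: cvgMr.
  rewrite -[X in _ --> X](@expR0 R) -(mul0r (ln (30^-1))).
  under eq_fun do rewrite /powR invr_eq0 pnatr_eq0 /=.
  apply: (@cvg_comp _ _ _ (fun n : nat => n.+1%:R^-1 * ln (30^-1)) expR).
    by apply: cvgMl; exact: cvg_harmonic.
  exact: continuous_expR.
apply: (squeeze_cvgr _ lim (cvg_cst mu)).
apply: nearW => n; apply/andP; split.
  rewrite -{1}(rootE n) -powRM ?exprn_ge0 ?(ltW mu0) ?invr_ge0 //.
  rewrite ge0_ler_powR ?nnegrE ?invr_ge0 //.
    by rewrite mulr_ge0 // ?invr_ge0 // exprn_ge0 // ltW.
  by rewrite fE ler_pM2l ?exprn_gt0.
rewrite -[leRHS](rootE n) ge0_ler_powR ?nnegrE ?invr_ge0 //.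
  by rewrite exprn_ge0 // ltW.
by rewrite fE ger_pMr ?exprn_gt0.
Qed.

End Renewal.
End Growth.

(** * Sturmian words *)

Section Sturmian.
Variable R : realType.
Implicit Types (t rho : R) (k l : nat).

Definition slope : R := Num.sqrt 2 - 1.

Lemma slope_sqr : slope ^+ 2 = 1 - 2 * slope.
Proof.
have /sqr_sqrtr : 0 <= 2 :> R by [].
by rewrite /slope => h; rewrite sqrrB1 h; ring.
Qed.

Lemma slope_bounds : 0 < slope < 1 / 2.
Proof.
have s0 : 0 <= Num.sqrt 2 :> R by exact: sqrtr_ge0.
have /sqr_sqrtr h : 0 <= 2 :> R by [].
by rewrite /slope; apply/andP; split; nra.
Qed.

Lemma slope_lt : slope < 1 / 2. Proof. by case/andP: slope_bounds. Qed.

(* The odd powers of the slope are the positive values of [q * slope - p]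
   given by the convergents of its continued fraction. *)
Lemma slope_convergent n :
  exists q p : nat, slope ^+ n.*2.+1 = q%:R * slope - p%:R.
Proof.
elim: n => [|n [q [p IH]]]; first by exists 1%N, 0%N; rewrite expr1; ring.
(* Multiplying by [slope ^+ 2 = 1 - 2 * slope] and reducing the new square in the same way yields
   these coefficients. *)
exists (5 * q + 2 * p)%N, (2 * q + p)%N.
rewrite doubleS -addn2 exprD IH slope_sqr !(natrM, natrD).
have -> : (q%:R * slope - p%:R) * (1 - 2 * slope) =
  (q%:R + 2 * p%:R) * slope - p%:R - 2 * q%:R * slope ^+ 2 by ring.
by rewrite slope_sqr; ring.
Qed.

Lemma slope_small (e : R) : 0 < e -> exists q p : nat,
  0 < q%:R * slope - p%:R < e.
Proof.
move=> e0; have /andP[s0 s1] := slope_bounds.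
have [n ne] : exists n : nat, slope ^+ n.*2.+1 < e.
  have : (slope ^+ n) @[n --> \oo] --> 0 by apply: cvg_expr; rewrite gtr0_norm; lra.
  move/cvgrPdist_lt => /(_ e e0)[N _ hN]; exists N.
  have /= := hN N.*2.+1; rewrite sub0r normrN gtr0_norm ?exprn_gt0 //.
  by apply; lia.
have [q [p h]] := slope_convergent n; exists q, p.
by rewrite -h exprn_gt0.
Qed.

(** Otherwise [k * (q * slope - p)] would be an integer, although it lies strictly between 0 and 1
    once [q * slope - p] is positive and below [1 / k]. *)
Lemma slope_irrational (k : nat) (m : int) : (0 < k)%N -> k%:R * slope != m%:~R.
Proof.
move=> k0; apply/eqP => h.
have kR : 0 < k%:R :> R by rewrite ltr0n.
have [|q [p /andP[lo hi]]] := @slope_small (k%:R^-1); first by rewrite invr_gt0.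
have e : k%:R * (q%:R * slope - p%:R) = (q%:Z * m - k%:Z * p%:Z)%:~R :> R.
  rewrite mulrBr mulrCA h rmorphB !rmorphM /=; ring.
have : 0 < k%:R * (q%:R * slope - p%:R) by rewrite mulr_gt0.
have : k%:R * (q%:R * slope - p%:R) < 1 by rewrite -ltr_pdivlMl // mulr1.
by rewrite e ltrz1 ltr0z; lia.
Qed.

(** * Density of rotation orbits *)

Definition frac (t : R) : R := t - (Num.floor t)%:~R.

Lemma frac_itv t : 0 <= frac t < 1.
Proof.
have /andP[] := floor_itv t; rewrite intrD /frac; lra.
Qed.

Lemma floor_frac t k :
  Num.floor (t + k%:R * slope) = Num.floor t + Num.floor (frac t + k%:R * slope).
Proof.
rewrite -[in LHS](subrK (Num.floor t)%:~R t) -/(frac t) -addrA [_%:~R + _]addrC.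
rewrite addrA floorDrz ?intr_int // intrKfloor.
exact: addrC.
Qed.

Lemma orbit_dense rho (a b : R) N : 0 <= a -> a < b -> b <= 1 ->
  exists2 i, (N <= i)%N & a < frac (rho + i%:R * slope) < b.
Proof.
move=> a0 ab b1.
have [|q [p]] := @slope_small (b - a); first by rewrite subr_gt0.
set d := _ - _ => /andP[d0 dba].
pose t := frac (rho + N%:R * slope).
have /andP[t0 t1] := frac_itv (rho + N%:R * slope).
rewrite -/t in t0 t1.
(* Every [q] further indices advance the orbit by [d < b - a] modulo 1. After [m + 1] such steps it
   first passes [a + 1], the copy of [a] one turn later, and so lands between [a + 1] and
   [b + 1]. *)
pose m := Num.trunc ((a + 1 - t) / d).
have at0 : 0 <= (a + 1 - t) / d by apply: divr_ge0; lra.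
have /andP[m1 m2] := trunc_itv at0; rewrite -/m in m1 m2.
have {}m1 : m%:R * d <= a + 1 - t by rewrite -ler_pdivlMr.
have {}m2 : a + 1 - t < (m%:R + 1) * d by rewrite -ltr_pdivrMr // natr1.
exists (N + m.+1 * q)%N; first by rewrite leq_addr.
have -> : frac (rho + (N + m.+1 * q)%:R * slope) = t + m.+1%:R * d - 1.
  rewrite /frac; set F := Num.floor _.
  suff -> : F = Num.floor (rho + N%:R * slope) + (m.+1 * p)%:Z + 1.
    rewrite /t /frac /d !intrD natrD !natrM -!pmulrn natrM; ring.
  apply: floor_def; rewrite !intrD -!pmulrn natrD !natrM.
  have -> : rho + (N%:R + m.+1%:R * q%:R) * slope =
    t + (Num.floor (rho + N%:R * slope))%:~R + m.+1%:R * d + m.+1%:R * p%:R.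
    rewrite /t /frac /d; ring.
  rewrite -natr1; nra.
by rewrite -natr1; apply/andP; split; nra.
Qed.

(** * Rotation words and their factors *)

Definition sturmian rho (j : nat) : bool :=
  Num.floor (rho + j.+1%:R * slope) != Num.floor (rho + j%:R * slope).

Lemma floor_step t k :
  Num.floor (t + k.+1%:R * slope) = Num.floor (t + k%:R * slope) + sturmian t k.
Proof.
rewrite /sturmian; have /andP[s0 s1] := slope_bounds.
have /andP[] := floor_itv (t + k%:R * slope).
have /andP[] := floor_itv (t + k.+1%:R * slope).
set F := Num.floor _; set G := Num.floor _; rewrite !intrD -natr1 => h1 h2 h3 h4.
have : F < G + 2 by rewrite -(ltr_int R) intrD; lra.
have : G < F + 1 by rewrite -(ltr_int R) intrD; lra.
by case: eqP => [->|]; lia.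
Qed.

Lemma sturmian_frac rho j k :
  sturmian rho (j + k) = sturmian (frac (rho + j%:R * slope)) k.
Proof.
have h i : Num.floor (rho + (j + i)%:R * slope) =
  Num.floor (rho + j%:R * slope) +
  Num.floor (frac (rho + j%:R * slope) + i%:R * slope).
  by rewrite -floor_frac natrD mulrDl addrA.
by rewrite /sturmian -addnS !h (inj_eq (addrI _)).
Qed.

(** A shift of the word moves the intercept along the orbit, so factors can be studied as
    prefixes. *)
Lemma factor_sturmian rho j l :
  word_factor (sturmian rho) j l =
  word_factor (sturmian (frac (rho + j%:R * slope))) 0 l.
Proof.
rewrite /word_factor -[X in iota X l]addn0 iotaDl -map_comp; apply: eq_map => k /=.
exact: sturmian_frac.
Qed.

(** For [k > 0], the intercept [t] in [[0, 1)] at which the floor of [t + k * slope] jumps. *)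
Definition cutpoint k : R := 1 - frac (k%:R * slope).

(** Left ends of the intervals of intercepts that share a prefix of length [l]. *)
Definition cutpoints l : seq R := 0 :: [seq cutpoint k | k <- iota 1 l].

Definition sturmian_factors l : seq (seq bool) :=
  [seq word_factor (sturmian t) 0 l | t <- cutpoints l].

Lemma cutpoint_bounds k : (0 < k)%N -> 0 < cutpoint k < 1.
Proof.
move=> k0; have /andP[f0 f1] := frac_itv (k%:R * slope).
have f0' : frac (k%:R * slope) != 0 by rewrite subr_eq0 slope_irrational.
have : 0 < frac (k%:R * slope) by rewrite lt0r f0' f0.
by rewrite /cutpoint; lra.
Qed.

Lemma cutpoint_inj : injective cutpoint.
Proof.
suff H j k : (j < k)%N -> cutpoint j != cutpoint k.
  move=> j k e; case: (ltngtP j k) => // /H; first by rewrite e eqxx.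
  by rewrite e eqxx.
move=> jk; apply/eqP => e.
have /eqP := @slope_irrational (k - j) (Num.floor (k%:R * slope) -
  Num.floor (j%:R * slope)) ltac:(lia); apply.
rewrite natrB 1?ltnW // intrB mulrBl.
by move: e; rewrite /cutpoint /frac; lra.
Qed.

Lemma floor_cutpoint t k : 0 <= t < 1 ->
  Num.floor (t + k%:R * slope) = Num.floor (k%:R * slope) + (cutpoint k <= t).
Proof.
move=> /andP[t0 t1]; have /andP[] := floor_itv (k%:R * slope).
rewrite intrD => h1 h2.
apply: floor_def; have [h|h] := lerP (cutpoint k) t;
  by move: h; rewrite /cutpoint /frac !intrD /=; lra.
Qed.

Definition same_floors l t t' : Prop := forall k, (k <= l)%N ->
  Num.floor (t + k%:R * slope) = Num.floor (t' + k%:R * slope).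

(** Both intercepts have floor 0, and the letters are the increments of the floors. *)
Lemma eq_factor_floors l t t' : 0 <= t < 1 -> 0 <= t' < 1 ->
  word_factor (sturmian t) 0 l = word_factor (sturmian t') 0 l <->
  same_floors l t t'.
Proof.
move=> ht ht'; split=> [/eq_in_map h|h]; last first.
  apply/eq_in_map => k; rewrite mem_iota => kl; rewrite /sturmian !h //; lia.
elim=> [_|k IH kl].
  by rewrite !mul0r !addr0 !(@floor_def _ _ 0) //; apply/andP; lra.
by rewrite !floor_step IH 1?ltnW // h // mem_iota; lia.
Qed.

Lemma cutpoints_itv l t : t \in cutpoints l -> 0 <= t < 1.
Proof.
rewrite inE => /predU1P[->|/mapP[k + ->]]; first by rewrite lexx ltr01.
by rewrite mem_iota => /andP[k1 _]; have /andP[/ltW -> ->] := cutpoint_bounds k1.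
Qed.

(** Of two left ends, the larger one is [cutpoint k] for some [k], and the floor with index [k]
    jumps exactly there. *)
Lemma sturmian_factors_uniq l : uniq (sturmian_factors l).
Proof.
have lt_neq t t' : t \in cutpoints l -> t' \in cutpoints l -> t < t' ->
    word_factor (sturmian t) 0 l <> word_factor (sturmian t') 0 l.
  move=> tl tl' tt /eq_factor_floors-/(_ (cutpoints_itv tl) (cutpoints_itv tl')).
  have /andP[t0 t1] := cutpoints_itv tl.
  move: tl'; rewrite inE => /predU1P[e|]; first by move: tt; rewrite e; lra.
  case/mapP=> k; rewrite mem_iota => kl e /(_ k ltac:(lia)).
  rewrite !floor_cutpoint ?(cutpoints_itv tl) //; last first.
    by rewrite e; have /andP[/ltW -> ->] := @cutpoint_bounds k ltac:(lia).
  by rewrite -e lexx leNgt tt /=; lia.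
rewrite map_inj_in_uniq.
  rewrite /= map_inj_uniq ?iota_uniq ?andbT; last exact: cutpoint_inj.
  apply/mapP => -[k]; rewrite mem_iota => kl e.
  by have := @cutpoint_bounds k ltac:(lia); rewrite -e ltxx.
move=> t t' tl tl' e; case: (ltgtP t t') => // tt; exfalso.
  exact: (lt_neq _ _ tl tl' tt e).
exact: (lt_neq _ _ tl' tl tt (esym e)).
Qed.

Lemma size_sturmian_factors l : size (sturmian_factors l) = l.+1.
Proof. by rewrite size_map /= size_map size_iota. Qed.

Lemma sturmian_factors_size l v : v \in sturmian_factors l -> size v = l.
Proof. by case/mapP => t _ ->; rewrite size_map size_iota. Qed.

Lemma cutpoint_below l t : 0 <= t < 1 ->
  exists2 t0, t0 \in cutpoints l & t0 <= t /\ same_floors l t0 t.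
Proof.
move=> ht; elim: l => [|l [t0 t0l [t0t sf]]].
  exists 0; rewrite ?mem_head //; case/andP: (ht) => t0 t1; split=> //.
  move=> k; rewrite leqn0 => /eqP ->.
  by rewrite !mul0r !addr0 !(@floor_def _ _ 0) //; apply/andP; lra.
have t0i := cutpoints_itv t0l.
have mono : {subset cutpoints l <= cutpoints l.+1}.
  move=> u; rewrite in_cons => /predU1P[->|/mapP[k kl ->]].
    exact: mem_head.
  rewrite in_cons; apply/orP; right; apply: map_f.
  by move: kl; rewrite !mem_iota; lia.
have [e|ne] := eqVneq (Num.floor (t0 + l.+1%:R * slope))
                      (Num.floor (t + l.+1%:R * slope)).
  exists t0; first exact: mono.
  by split=> // k; rewrite leq_eqVlt => /predU1P[->|/sf].
move: (ne); rewrite !floor_cutpoint // (inj_eq (addrI _)).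
have [c0|c0] := lerP (cutpoint l.+1) t0; first by rewrite (le_trans c0 t0t).
have [c1 _|//] := lerP (cutpoint l.+1) t.
(* The new floors differ only if the new cut point lies above [t0] and not above [t]; the earlier
   floors are then squeezed between those at [t0] and [t]. *)
exists (cutpoint l.+1).
  by rewrite in_cons; apply/orP; right; apply: map_f; rewrite mem_iota; lia.
split=> // k; rewrite leq_eqVlt => /predU1P[->|kl].
  have /andP[/ltW i1 i2] := @cutpoint_bounds l.+1 isT.
  by rewrite !floor_cutpoint // ?i1 ?i2 // c1 lexx.
apply/eqP; rewrite eq_le; apply/andP; split; last rewrite -(sf k kl).
  by apply: le_floor; rewrite lerD2r.
by apply: le_floor; rewrite lerD2r ltW.
Qed.

Lemma mem_sturmian_factors rho j l :
  word_factor (sturmian rho) j l \in sturmian_factors l.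
Proof.
rewrite factor_sturmian; set t := frac _.
have ht : 0 <= t < 1 by exact: frac_itv.
have [t0 t0l [_ sf]] := cutpoint_below l ht; apply/mapP; exists t0 => //.
apply/esym/eq_factor_floors => //; exact: cutpoints_itv t0l.
Qed.

Lemma same_floors_right l t : 0 <= t < 1 ->
  exists2 u, t < u <= 1 & forall t', t <= t' < u -> same_floors l t t'.
Proof.
move=> /andP[t0 t1]; elim: l => [|l [u tu1 hu]].
  exists 1; first by rewrite t1 lexx.
  move=> t' /andP[h1 h2] k; rewrite leqn0 => /eqP ->.
  by rewrite !mul0r !addr0 !(@floor_def _ _ 0) //; apply/andP; lra.
have /andP[h1] := floor_itv (t + l.+1%:R * slope).
set F := Num.floor _ in h1 *; rewrite intrD => h2.
exists (Num.min u (F%:~R + 1 - l.+1%:R * slope)).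
  by rewrite lt_min ge_min; case/andP: tu1 => -> ->; rewrite /= andbT; lra.
move=> t' /andP[h3]; rewrite lt_min => /andP[h4 h5] k.
rewrite leq_eqVlt => /predU1P[->|kl]; last by apply: hu => //; rewrite h3.
by apply/esym/floor_def; rewrite -/F intrD; lra.
Qed.

(** A prefix belongs to a whole interval of intercepts, which the orbit of every [rho] enters beyond
    any index. *)
Lemma sturmian_recurrent rho N l v : v \in sturmian_factors l ->
  exists2 j, (N <= j)%N & word_factor (sturmian rho) j l = v.
Proof.
case/mapP=> t /cutpoints_itv ht ->.
have [u /andP[tu u1] hu] := same_floors_right l ht.
have /andP[t0 t1] := ht.
have [j Nj /andP[h1 h2]] := @orbit_dense rho t u N t0 tu u1.
exists j => //; rewrite factor_sturmian; apply/esym/eq_factor_floors => //.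
  exact: frac_itv.
by apply: hu; rewrite h2 ltW.
Qed.

(** Two successive jumps would need [2 * slope > 1]. *)
Lemma sturmian_factors_11 : [:: true; true] \notin sturmian_factors 2.
Proof.
apply/mapP => -[t /cutpoints_itv /andP[t0 t1] [e0 e1]].
have e2 : Num.floor (t + 2%:R * slope) = Num.floor (t + 0%:R * slope) + 1 + 1.
  by rewrite (floor_step t 1) (floor_step t 0) -e0 -e1.
have s1 := slope_lt.
have /andP[+ _] := floor_itv (t + 2%:R * slope).
have /andP[_ +] := floor_itv (t + 0%:R * slope).
by rewrite e2 !intrD /=; lra.
Qed.

(** Density puts some cut point strictly between two different intercepts, and there the floors
    differ. *)
Lemma sturmian_inj rho rho' : 0 <= rho < 1 -> 0 <= rho' < 1 ->
  sturmian rho = sturmian rho' -> rho = rho'.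
Proof.
suff H r r' : 0 <= r -> r < r' -> r' < 1 -> sturmian r <> sturmian r'.
  move=> /andP[r0 r1] /andP[r0' r1'] e; case: (ltgtP rho rho') => // h; exfalso.
    exact: (H rho rho').
  exact: (H rho' rho).
move=> r0 rr r1 e.
have [|||j _ /andP[h1 h2]] := @orbit_dense 0 (1 - r') (1 - r) 0 _ _ _; try lra.
have hr : 0 <= r < 1 by lra.
have hr' : 0 <= r' < 1 by lra.
have /eq_factor_floors-/(_ hr hr')/(_ j (leqnn j)) :
  word_factor (sturmian r) 0 j = word_factor (sturmian r') 0 j by rewrite e.
rewrite !floor_cutpoint // /cutpoint -[j%:R * slope]add0r.
have -> : (1 - frac (0 + j%:R * slope) <= r) = false by apply/negP; lra.
have -> : (1 - frac (0 + j%:R * slope) <= r') by lra.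
by rewrite addr0 => /eqP; rewrite eq_sym -subr_eq0 addrAC subrr add0r.
Qed.

End Sturmian.

(** * Gridded permutations of sets of pins *)

Lemma code_ext s (q q' : seq nat) : size q = size q' ->
  (forall k, (k < size q)%N -> s (nth 0%N q k) = s (nth 0%N q' k)) ->
  (forall k l, (k < l < size q)%N ->
     cross s (nth 0%N q k) (nth 0%N q l) = cross s (nth 0%N q' k) (nth 0%N q' l)) ->
  pcode s q = pcode s q'.
Proof.
elim: q q' => [|a q IH] [|a' q'] //= /succn_inj sz hs hc.
rewrite (IH q' sz); last 2 first.
- by move=> k kq; exact: (hs k.+1).
- by move=> k l kl; exact: (hc k.+1 l.+1).
rewrite (hs 0%N) //; congr ((_, _) :: _).
rewrite /crossings -sz; apply: eq_in_filter => k; rewrite mem_iota => kq.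
exact: (hc 0%N k.+1).
Qed.

(** Crossings compare a lower point with a higher one; injectivity of [xkey] supplies the reverse
    comparison. *)
Lemma code_eq_xkey s (q q' : seq nat) k l : pcode s q = pcode s q' ->
  uniq q -> uniq q' -> (k < size q)%N -> (l < size q)%N ->
  s (nth 0%N q k) = s (nth 0%N q l) ->
  (xkey (nth 0%N q k) < xkey (nth 0%N q l))%N =
  (xkey (nth 0%N q' k) < xkey (nth 0%N q' l))%N.
Proof.
move=> e uq uq' kq lq skl.
have sz : size q = size q' by rewrite -(size_code s) e size_code.
have sE j : (j < size q)%N -> s (nth 0%N q j) = s (nth 0%N q' j).
  move=> jq; have := congr1 (map fst) e; rewrite !map_fst_code.
  by move/(congr1 (fun r => nth false r j)); rewrite !(nth_map 0%N) // -sz.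
have cE i j : (i < j)%N -> (j < size q)%N -> s (nth 0%N q i) = s (nth 0%N q j) ->
    (xkey (nth 0%N q j) < xkey (nth 0%N q i))%N =
    (xkey (nth 0%N q' j) < xkey (nth 0%N q' i))%N.
  move=> ij jq sij; have jq' : (j < size q')%N by rewrite -sz.
  have := mem_crossings_pcode s (false, [::]) ij jq.
  rewrite e (mem_crossings_pcode s _ ij jq') /cross -!sE ?(ltn_trans ij) // sij eqxx /=.
  by move=> ->.
case: (ltngtP k l) => [kl|lk|->]; last by rewrite !ltnn.
- have ne (r : seq nat) : uniq r -> size r = size q ->
      xkey (nth 0%N r k) != xkey (nth 0%N r l).
    move=> ur sr; rewrite (inj_eq xkey_inj) nth_uniq ?sr //; lia.
  have := cE k l kl lq skl; have := ne q uq erefl; have := ne q' uq' (esym sz).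
  lia.
- exact: (cE l k lk kq (esym skl)).
Qed.

Lemma ysort_ltn (S : seq nat) k l : uniq S -> (k < size S)%N -> (l < size S)%N ->
  (ykey (nth 0%N (ysort S) k) < ykey (nth 0%N (ysort S) l))%N = (k < l)%N.
Proof.
move=> uS kS lS; have h i j : (j < size S)%N -> (i < j)%N ->
    (ykey (nth 0%N (ysort S) i) < ykey (nth 0%N (ysort S) j))%N.
  move=> jS ij; apply: (sorted_ltn_nth yltn_trans 0%N (ysort_sorted uS)) => //;
  by rewrite inE size_ysort // (ltn_trans ij).
case: (ltngtP k l) => [/h-> //|/h|->]; last by rewrite ltnn.
by move=> /(_ kS); lia.
Qed.

(** * Pin sequences of the words built from binary words *)

Section Geometry.
Variables (R : realType) (x : nat -> bool).
Implicit Types p : nat -> R * R.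

Definition pin_letter (i : nat) : letter :=
  match odd i, side x i with
  | false, true => lu | false, false => ru
  | true, true => ul | true, false => ur
  end.

Lemma side_succ i : ~~ odd i -> side x i.+1 = side x i.
Proof. by move=> ei; rewrite /side; congr x; lia. Qed.

Lemma pin_word_letter : pin_word pin_letter.
Proof.
move=> i; rewrite /pin_letter; case ei: (odd i); rewrite /= ei /=.
  by case: (side x i); case: (side x i.+1).
by rewrite side_succ ?ei //; case: (side x i).
Qed.

(** The relative position of all pins in terms of the keys, replacing the recursive description by
    rectangles. *)
Definition shaped p : Prop :=
  [/\ forall i, 0 < (p i).2,
      forall i, if side x i then (p i).1 < 0 else 0 < (p i).1,
      forall i j, (ykey i < ykey j)%N -> (p i).2 < (p j).2 &
      forall i j, side x i = side x j -> (xkey i < xkey j)%N ->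
        if side x i then (p j).1 < (p i).1 else (p i).1 < (p j).1].

Lemma rect_right_ltP p k (a : R) : reflect
  (0 < a /\ forall j, (j < k)%N -> (p j).1 < a) (rect_right p k < a).
Proof.
apply: (iffP (bigmax_ltP _ _ _ _)) => -[a0 h]; split=> //.
  by move=> j jk; exact: (h (Ordinal jk)).
by move=> j _; exact: h.
Qed.

Lemma rect_top_ltP p k (a : R) : reflect
  (0 < a /\ forall j, (j < k)%N -> (p j).2 < a) (rect_top p k < a).
Proof.
apply: (iffP (bigmax_ltP _ _ _ _)) => -[a0 h]; split=> //.
  by move=> j jk; exact: (h (Ordinal jk)).
by move=> j _; exact: h.
Qed.

Lemma lt_rect_leftP p k (a : R) : reflect
  (a < 0 /\ forall j, (j < k)%N -> a < (p j).1) (a < rect_left p k).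
Proof.
apply: (iffP (bigmin_gtP _ _ _ _)) => -[a0 h]; split=> //.
  by move=> j jk; exact: (h (Ordinal jk)).
by move=> j _; exact: h.
Qed.

Lemma rect_bottom_le0 p k : rect_bottom p k <= 0.
Proof. exact: bigmin_le_id. Qed.

Section PinSequence.
Variable p : nat -> R * R.
Hypothesis pp : pin_sequence pin_letter p.

Let up_y i : ~~ odd i -> 0 < (p i.+1).2 /\
  forall j, (j <= i)%N -> (p j).2 < (p i.+1).2.
Proof.
move=> ei; have [+ _] := pp.2 i; rewrite /pin_letter /= ei.
by case: (side x i.+1) => /= /rect_top_ltP.
Qed.

Let horizontal_x i : odd i ->
  if side x i.+1
  then (p i.+1).1 < 0 /\ forall j, (j <= i)%N -> (p i.+1).1 < (p j).1
  else 0 < (p i.+1).1 /\ forall j, (j <= i)%N -> (p j).1 < (p i.+1).1.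
Proof.
move=> oi; have [+ _] := pp.2 i; rewrite /pin_letter /= oi /=.
by case: (side x i.+1) => /= [/lt_rect_leftP|/rect_right_ltP].
Qed.

Let horizontal_y i : odd i -> [/\ 0 < (p i.+1).2, (p i.+1).2 < (p i).2 &
  forall j, (j < i)%N -> (p j).2 < (p i.+1).2].
Proof.
move=> oi; have hx := horizontal_x oi.
have yi : 0 < (p i).2 by case: i oi {hx} => // i oi; have [] := @up_y i oi.
(* Pin [i + 1] is extreme on its side, which excludes a horizontal separation; a separation below
   the axis fails because pin [i] has positive height. *)
have [_ [/orP[]|/orP[]]] := pp.2 i => /andP[h1 h2].
- case/rect_right_ltP: h1 => h1 _; case: (side x i.+1) hx => -[h3 h4].
    by move: h1 h3; lra.
  by have := h4 i (leqnn i); lra.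
- case/lt_rect_leftP: h2 => h2 _; case: (side x i.+1) hx => -[h3 h4].
    by have := h4 i (leqnn i); lra.
  by move: h2 h3; lra.
- by case/rect_top_ltP: h1.
- by have := rect_bottom_le0 p i; lra.
Qed.

Let even_x i : ~~ odd i -> if side x i then (p i).1 < 0 else 0 < (p i).1.
Proof.
case: i => [_|i]; last first.
  by rewrite negbK => /horizontal_x; case: (side x i.+1) => -[].
have [+ _] := pp; rewrite /pin_letter /=.
by case: (side x 0) => /= /andP[].
Qed.

Let up_x i : ~~ odd i ->
  if side x i
  then [/\ (p i.+1).1 < 0, (p i).1 < (p i.+1).1 &
           forall j, (j < i)%N -> (p i.+1).1 < (p j).1]
  else [/\ 0 < (p i.+1).1, (p i.+1).1 < (p i).1 &
           forall j, (j < i)%N -> (p j).1 < (p i.+1).1].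
Proof.
move=> ei; have sx := even_x ei; have [y0 yj] := up_y ei.
have yi := yj i (leqnn i).
(* Pin [i + 1] is higher than pin [i] and above the axis, which leaves only a horizontal separation,
   on the side of pin [i]. *)
have [_ [/orP[]|/orP[]]] := pp.2 i => /andP[h1 h2].
- case/rect_right_ltP: h1 => h1 h3; case: (side x i) sx => sx //.
  by move: h1 h2 sx; lra.
- case/lt_rect_leftP: h2 => h2 h3; case: (side x i) sx => sx //.
  by move: h1 h2 sx; lra.
- by move: h2; lra.
- by have := rect_bottom_le0 p i; lra.
Qed.

Lemma pin_sequence_shaped : shaped p.
Proof.
split.
- case=> [|i].
    by have [+ _] := pp; rewrite /pin_letter /=; case: (side x 0) => /= /andP[].
  by case oi: (odd i); [have [] := horizontal_y oi|have [] := up_y (negbT oi)].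
- move=> i; case oi: (odd i); last exact: (even_x (negbT oi)).
  case: i oi => // i /= oi; rewrite side_succ //.
  by have := up_x oi; case: (side x i) => -[].
- move=> i j; case: j => [|j]; first by rewrite /ykey /=; case: ifP; lia.
  case oj: (odd j).
    have [_ _ h] := horizontal_y oj; move=> ij; apply: h.
    by move: ij; rewrite /ykey /= oj /=; case: ifP; lia.
  have [_ h] := up_y (negbT oj) => ij.
  (* The horizontal pin [j + 2] is the only later pin below the up pin [j + 1]. *)
  have [e|ne] := eqVneq i j.+2.
    have [//|_ h2 _] := @horizontal_y j.+1; first by rewrite /= oj.
    by rewrite e.
  by apply: h; move: ij; rewrite /ykey /= oj /=; case: ifP; lia.
- move=> i j sij; rewrite sij; case oj: (odd j).
    case: j oj sij => // j /= oj sij ij; rewrite side_succ //.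
    have ij' : (i < j)%N by move: ij; rewrite /xkey /= oj; case: ifP; lia.
    by have := up_x oj; case: (side x j) => -[_ _ /(_ i ij')].
  (* The up pin [j + 1] is the only later pin whose [xkey] is smaller than that of the horizontal
     pin [j]. *)
  have [e ij|ne ij] := eqVneq i j.+1.
    by have := up_x (negbT oj); rewrite e; case: (side x j) => -[].
  have {ne} ij' : (i < j)%N.
    by move: ij ne; rewrite /xkey oj; case: ifP; lia.
  case: j oj sij ij ij' => // j /= oj sij ij ij'.
  have := horizontal_x (negbFE oj).
  by case: (side x j.+1) => -[_ /(_ i ij')].
Qed.

End PinSequence.

Lemma shaped_pin_sequence p : shaped p -> pin_sequence pin_letter p.
Proof.
case=> y0 xs yh xh; split.
  have := y0 0%N; have := xs 0%N; rewrite /pin_letter /=.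
  by case: (side x 0) => /= -> ->.
move=> i; case oi: (odd i).
  have yl j : (j < i)%N -> (p j).2 < (p i.+1).2.
    by move=> ji; apply: yh; rewrite /ykey /= oi /=; case: ifP; lia.
  split; last first.
    right; apply/orP; left; apply/andP; split; first exact/rect_top_ltP.
    by apply: yh; rewrite /ykey /= oi /=; lia.
  rewrite /pin_letter /= oi /=.
  have xj j : (j < i.+1)%N -> side x j = side x i.+1 ->
      if side x i.+1 then (p i.+1).1 < (p j).1 else (p j).1 < (p i.+1).1.
    move=> ji sj; have := xh j i.+1 sj; rewrite sj; apply.
    by rewrite /xkey /= oi /=; case: ifP; lia.
  have := xs i.+1; case si: (side x i.+1) xj => /= xj x0.
    apply/lt_rect_leftP; split=> // j ji.
    have := xs j; case sj: (side x j) => h; first exact: xj.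
    by lra.
  apply/rect_right_ltP; split=> // j ji.
  have := xs j; case sj: (side x j) => h; last exact: xj.
  by lra.
split.
  suff h : rect_top p i.+1 < (p i.+1).2.
    by rewrite /pin_letter /= oi /=; case: (side x i.+1).
  apply/rect_top_ltP; split=> // j ji.
  by apply: yh; rewrite /ykey /= oi /=; case: ifP; lia.
left; have sS : side x i.+1 = side x i by rewrite side_succ // oi.
have ii : (xkey i.+1 < xkey i)%N by rewrite /xkey /= oi /=; lia.
have xj j : (j < i)%N -> side x j = side x i ->
    if side x i then (p i.+1).1 < (p j).1 else (p j).1 < (p i.+1).1.
  move=> ji sj; have := xh j i.+1; rewrite sS sj; apply=> //.
  by rewrite /xkey /= oi /=; case: ifP; lia.
have := xh _ _ sS ii; have := xs i.+1; rewrite sS.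
case si: (side x i) xj => /= xj x0 x1; apply/orP; [right|left]; apply/andP.
  split=> //; apply/lt_rect_leftP; split=> // j ji.
  have := xs j; case sj: (side x j) => h; first exact: xj.
  by lra.
split=> //; apply/rect_right_ltP; split=> // j ji.
have := xs j; case sj: (side x j) => h; last exact: xj.
by lra.
Qed.

(** A concrete realisation by the keys, increased by 1 to avoid the axes. *)
Definition pin_points (i : nat) : R * R :=
  ((if side x i then -1 else 1) * (xkey i).+1%:R, (ykey i).+1%:R).

Lemma pin_points_shaped : shaped pin_points.
Proof.
split=> [i|i|i j ij|i j sij ij]; rewrite /= ?ltr0n ?ltr_nat //.
  by case: (side x i); rewrite ?mulN1r ?mul1r ?oppr_lt0 ltr0n.
by rewrite -sij; case: (side x i);
  rewrite ?mulN1r ?mul1r ?ltrN2 ltr_nat.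
Qed.

Lemma shaped_y_lt p i j : shaped p -> ((p i).2 < (p j).2) = (ykey i < ykey j)%N.
Proof.
case=> _ _ h _; case: (ltngtP (ykey i) (ykey j)) => [/h-> //|/h/ltW|/ykey_inj->].
  by rewrite leNgt => /negPf.
exact: ltxx.
Qed.

Lemma shaped_x_lt p i j : shaped p -> ((p i).1 < (p j).1) =
  if side x i then ~~ side x j || (xkey j < xkey i)%N
  else ~~ side x j && (xkey i < xkey j)%N.
Proof.
move=> [_ xs _ h]; have := xs i; have := xs j.
have hij := h i j; have hji := h j i.
case si: (side x i) hij hji; case sj: (side x j) => hij hji xj xi /=.
- case: (ltngtP (xkey i) (xkey j)) => [/hij|/hji|/xkey_inj->].
  + by move=> /(_ erefl) /ltW; rewrite leNgt => /negPf.
  + by move=> ->.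
  + exact: ltxx.
- by lra.
- by apply/negbTE; rewrite -leNgt; lra.
- case: (ltngtP (xkey i) (xkey j)) => [/hij|/hji|/xkey_inj->].
  + by move=> ->.
  + by move=> /(_ erefl) /ltW; rewrite leNgt => /negPf.
  + exact: ltxx.
Qed.

Lemma shaped_in_quadrant p i q : shaped p ->
  in_quadrant q (p i) = if side x i then if q is Q2 then true else false
                        else if q is Q1 then true else false.
Proof.
case=> /(_ i) y0 /(_ i) x0 _ _; case: q => /=; rewrite ?y0 ?andbT;
  case: (side x i) x0 => x0; rewrite ?x0 //;
  by apply/negbTE/negP; try case/andP; lra.
Qed.

Lemma shaped_x_inj p i j : shaped p -> (p i).1 = (p j).1 -> i = j.
Proof.
move=> sp e; have := shaped_x_lt i j sp; have := shaped_x_lt j i sp.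
rewrite e ltxx => h1 h2; apply: xkey_inj; move: h1 h2.
by case: (side x i); case: (side x j) => //=; lia.
Qed.

Lemma shaped_y_inj p i j : shaped p -> (p i).2 = (p j).2 -> i = j.
Proof.
move=> sp e; have := shaped_y_lt i j sp; have := shaped_y_lt j i sp.
by rewrite e ltxx => h1 h2; apply: ykey_inj; lia.
Qed.

Lemma shaped_inj p : shaped p -> injective p.
Proof. by move=> sp i j e; apply: (shaped_x_inj sp); rewrite e. Qed.

(** * Counting gridded permutations by codes *)

Lemma shaped_gpoints p (S : seq nat) : shaped p ->
  exists A : gpoints R, points A =i map p S.
Proof.
move=> sp; pose F : {fset R * R} := seq_fset tt (map p S).
have FE : F =i map p S by move=> a; rewrite seq_fsetE.
have gF : `[< gridded F >].
  apply/asboolP; split=> [a b|a b|a]; rewrite !FE.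
  - by case/mapP=> i _ -> /mapP[j _ ->] /(shaped_x_inj sp) ->.
  - by case/mapP=> i _ -> /mapP[j _ ->] /(shaped_y_inj sp) ->.
  - case/mapP=> i _ ->; have [y0 x0 _ _] := sp; rewrite (gt_eqF (y0 i)).
    by split=> //; have := x0 i; case: (side x i) => h; [rewrite lt_eqF|rewrite gt_eqF].
by exists (GPoints gF).
Qed.

Lemma gpoints_range p (A : gpoints R) : [set` points A] `<=` range p ->
  exists2 S, uniq S & points A =i map p S.
Proof.
move=> Ap; have /choice[h hp] : forall a, exists i, a \in points A -> p i = a.
  move=> a; case aA: (a \in points A); last by exists 0%N.
  by have [i _ <-] := Ap a aA; exists i.
have hI : {in points A &, injective h}.
  by move=> a b aA bA e; rewrite -(hp a aA) -(hp b bA) e.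
exists (map h (enum_fset (points A))); first by rewrite map_inj_in_uniq ?fset_uniq.
move=> a; rewrite -map_comp; apply/idP/mapP => [aA|[b bA ->]] /=.
  by exists a => //=; rewrite hp.
by rewrite hp.
Qed.

Lemma card_shaped p (A : gpoints R) S : shaped p -> uniq S ->
  points A =i map p S -> #|` points A| = size S.
Proof.
move=> sp uS AS; rewrite -(size_map p S); apply/perm_size/uniq_perm => //.
by rewrite map_inj_uniq //; exact: shaped_inj.
Qed.

(** Points are matched by their rank in height. The code gives the quadrants and the horizontal
    order within each of them. *)
Lemma same_gridding_code p p' (A A' : gpoints R) S S' :
  shaped p -> shaped p' -> uniq S -> uniq S' ->
  points A =i map p S -> points A' =i map p' S' ->
  pcode (side x) (ysort S) = pcode (side x) (ysort S') -> same_gridding A A'.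
Proof.
move=> sp sp' uS uS' AS AS' e.
set q := ysort S in e; set q' := ysort S' in e.
have uq : uniq q by rewrite ysort_uniq.
have uq' : uniq q' by rewrite ysort_uniq.
have szq : size q = size S by rewrite size_ysort.
have szq' : size q' = size S' by rewrite size_ysort.
have szqq : size q = size q' by rewrite -(size_code (side x)) e size_code.
have sE j : (j < size q)%N -> side x (nth 0%N q' j) = side x (nth 0%N q j).
  move=> jq; have := congr1 (map fst) e; rewrite !map_fst_code.
  by move/(congr1 (fun r => nth false r j)); rewrite !(nth_map 0%N) // -szqq.
pose f a := p' (nth 0%N q' (index a (map p q))).
have fE k : (k < size q)%N -> f (p (nth 0%N q k)) = p' (nth 0%N q' k).
  move=> kq; rewrite /f index_map ?index_uniq //; exact: shaped_inj.
have qA a : a \in points A -> exists2 k, (k < size q)%N & a = p (nth 0%N q k).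
  rewrite AS => /mapP[i iS ->]; exists (index i q).
    by rewrite index_mem mem_ysort.
  by rewrite nth_index // mem_ysort.
exists f; split.
- split.
  + move=> a /= /qA[k kq ->]; rewrite fE // AS'; apply: map_f.
    by rewrite -(mem_ysort S') mem_nth // -szqq.
  + move=> a b; rewrite !inE => /qA[k kq ->] /qA[l lq ->]; rewrite !fE //.
    move/(shaped_inj sp')/eqP; rewrite nth_uniq -?szqq // => /eqP -> //.
  + move=> b /=; rewrite AS' => /mapP[i]; rewrite -(mem_ysort S') -/q' => iq ->.
    have iq' : (index i q' < size q)%N by rewrite szqq index_mem.
    exists (p (nth 0%N q (index i q'))); last by rewrite fE // nth_index.
    by rewrite /= AS; apply: map_f; rewrite -(mem_ysort S) mem_nth.
- move=> a b /qA[k kq ->] /qA[l lq ->]; rewrite !fE // (shaped_x_lt _ _ sp').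
  rewrite (shaped_x_lt _ _ sp) !sE //.
  have := code_eq_xkey e uq uq' kq lq; have := code_eq_xkey e uq uq' lq kq.
  case: (side x (nth 0%N q k)); case: (side x (nth 0%N q l)) => //= h1 h2.
    by rewrite h1.
  by rewrite h2.
- move=> a b /qA[k kq ->] /qA[l lq ->]; rewrite !fE // (shaped_y_lt _ _ sp').
  by rewrite (shaped_y_lt _ _ sp) !ysort_ltn // -?szq -?szq' -?szqq.
- move=> a /qA[k kq ->] Q; rewrite fE //.
  by rewrite (shaped_in_quadrant _ _ sp') (shaped_in_quadrant _ _ sp) sE.
Qed.

(** A bijection preserving heights matches points by rank, since a set has only one strictly sorted
    enumeration; quadrants and horizontal order then yield the crossings. *)
Lemma same_gridding_code_inv p p' (A A' : gpoints R) S S' :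
  shaped p -> shaped p' -> uniq S -> uniq S' ->
  points A =i map p S -> points A' =i map p' S' ->
  same_gridding A A' -> pcode (side x) (ysort S) = pcode (side x) (ysort S').
Proof.
move=> sp sp' uS uS' AS AS' [f [fbij fx fy fq]].
set q := ysort S; set q' := ysort S'.
have uq : uniq q by rewrite ysort_uniq.
have uq' : uniq q' by rewrite ysort_uniq.
have szq : size q = size S by rewrite size_ysort.
have qA k : (k < size q)%N -> p (nth 0%N q k) \in points A.
  by move=> kq; rewrite AS map_f // -(mem_ysort S) mem_nth.
have fE : map (f \o p) q = map p' q'.
  pose lt2 (a b : R * R) := a.2 < b.2.
  have lt2_tr : transitive lt2 by move=> a b c; exact: lt_trans.
  have lt2_irr : irreflexive lt2 by move=> a; exact: ltxx.
  apply: (irr_sorted_eq lt2_tr lt2_irr).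
  - rewrite sorted_map; apply: (sub_in_sorted (P := mem S)) (ysort_sorted uS).
      move=> i j iS jS ij; rewrite /relpre /lt2 /= fy ?AS ?map_f //.
      by rewrite (shaped_y_lt _ _ sp).
    by apply/allP => i; rewrite mem_ysort.
  - rewrite sorted_map; apply: sub_sorted (ysort_sorted uS').
    by move=> i j; rewrite /relpre /lt2 /= (shaped_y_lt _ _ sp').
  - move=> b; apply/mapP/mapP => -[i iq -> /=].
      have : f (p i) \in points A'.
        by apply: (set_bij_homo fbij); rewrite /= AS map_f // -(mem_ysort S).
      rewrite AS' => /mapP[j jS' ->]; exists j => //.
      by rewrite mem_ysort.
    have : [set` points A'] (p' i) by rewrite /= AS' map_f // -(mem_ysort S').
    case/(set_bij_surj fbij) => a /=; rewrite AS => /mapP[j jS ->] <-.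
    by exists j; rewrite ?mem_ysort.
have szqq : size q = size q' by rewrite -(size_map (f \o p)) fE size_map.
have {}fE k : (k < size q)%N -> f (p (nth 0%N q k)) = p' (nth 0%N q' k).
  move=> kq; have := congr1 (fun r => nth (0, 0) r k) fE.
  by rewrite !(nth_map 0%N) // -szqq.
have sE k : (k < size q)%N -> side x (nth 0%N q k) = side x (nth 0%N q' k).
  move=> kq; have := fq _ (qA k kq) Q2; rewrite fE //.
  rewrite (shaped_in_quadrant _ _ sp') (shaped_in_quadrant _ _ sp).
  by case: (side x _); case: (side x _).
apply: code_ext => // k l /andP[kl lq]; have kq := ltn_trans kl lq.
have := fx _ _ (qA k kq) (qA l lq); have := fx _ _ (qA l lq) (qA k kq).
rewrite !fE // !(shaped_x_lt _ _ sp') !(shaped_x_lt _ _ sp) /cross !sE //.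
by case: (side x _); case: (side x _).
Qed.

Lemma card_same_gridding (A B : gpoints R) :
  same_gridding A B -> #|` points A| = #|` points B|.
Proof.
case=> f [[fh fi fs] _ _ _].
have fiA : {in points A &, injective f}.
  by move=> a b aA bA; apply: fi; rewrite inE.
rewrite -(card_in_imfset imfset_key fiA); congr #|` _|; apply/fsetP => b.
apply/imfsetP/idP => [[a aA ->]|bB]; first exact: (fh a aA).
by have [a aA <-] := fs b bB; exists a.
Qed.

Lemma glength_pi (A : gpoints R) : glength (\pi_(gperm R) A)%qT = #|` points A|.
Proof.
apply: card_same_gridding; apply/asboolP.
have /eqmodP // : (repr (\pi_(gperm R) A) = A %[mod gperm R])%qT by rewrite reprK.
Qed.

Lemma eq_pi_gperm (A B : gpoints R) :
  (\pi_(gperm R) A)%qT = (\pi_(gperm R) B)%qT <-> same_gridding A B.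
Proof. by split=> [/eqmodP/asboolP|h]; last exact/eqmodP/asboolP. Qed.

(** The code is a complete invariant that does not depend on the pin sequence, so every element can
    be realised on [pin_points]. *)
Lemma num_of_length_pin_class (codes : seq (seq (bool * seq nat))) n :
  uniq codes ->
  (forall S, uniq S -> size S = n -> pcode (side x) (ysort S) \in codes) ->
  (forall c, c \in codes ->
     exists S, [/\ uniq S, size S = n & pcode (side x) (ysort S) = c]) ->
  num_of_length (pin_class pin_letter : set (gperm R)) n = size codes.
Proof.
move=> uc cS cc; have sp0 := pin_points_shaped.
have /choice[h hP] : forall c, exists s : gperm R, c \in codes ->
    exists S (A : gpoints R), [/\ uniq S, size S = n,
      pcode (side x) (ysort S) = c, points A =i map pin_points S &
      s = (\pi_(gperm R) A)%qT].
  (* [A0] is a filler value for arguments outside [codes]. *)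
  have [A0 _] := shaped_gpoints [::] sp0.
  move=> c; case ccod : (c \in codes); last by exists (\pi_(gperm R) A0)%qT.
  have [S [uS szS eS]] := cc c ccod.
  have [A AS] := shaped_gpoints S sp0.
  by exists (\pi_(gperm R) A)%qT => _; exists S, A.
have hI : {in codes &, injective h}.
  move=> c c' /hP[S [A [uS _ <- AS ->]]] /hP[S' [A' [uS' _ <- AS' ->]]].
  move=> /eq_pi_gperm.
  exact: (same_gridding_code_inv sp0 sp0 uS uS' AS AS').
pose F : {fset gperm R} := seq_fset tt (map h codes).
rewrite /num_of_length (_ : [set s | _] = [set` F]).
  rewrite set_fsetK size_seq_fset undup_id ?size_map //.
  by rewrite map_inj_in_uniq.
apply/seteqP; split=> s /=; rewrite seq_fsetE.
  case=> -[p /pin_sequence_shaped sp [A -> /gpoints_range[S uS AS]]].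
  rewrite glength_pi (card_shaped sp uS AS) => szS.
  apply/mapP; exists (pcode (side x) (ysort S)); first exact: cS.
  have /hP[S' [A' [uS' _ e AS' ->]]] := cS S uS szS.
  by apply/eq_pi_gperm; exact: (same_gridding_code sp sp0 uS uS' AS AS' (esym e)).
case/mapP => c /hP[S [A [uS szS _ AS ->]]] ->; split; last first.
  by rewrite glength_pi (card_shaped sp0 uS AS).
exists pin_points; first exact: shaped_pin_sequence.
by exists A => // a /=; rewrite AS => /mapP[i _ ->]; exists i.
Qed.

End Geometry.

(** * Growth rate and uncountability *)

Lemma sturmian_growth (R : realType) (mu rho : R) : root (mu_poly R) mu ->
  328 / 100 < mu < 4 ->
  has_growth_rate (pin_class (pin_letter (sturmian rho))) mu.
Proof.
move=> mu_root /andP[mu_gt mu_lt].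
have fac_uniq := @sturmian_factors_uniq R.
have size_fac := @size_sturmian_factors R.
have fac_size := @sturmian_factors_size R.
have fac11 := @sturmian_factors_11 R.
pose codes := codes_of_len (@sturmian_factors R).
rewrite /has_growth_rate (_ : (fun n => _) =
    (fun n => (size (codes n))%:R `^ n%:R^-1)).
  by apply: renewal_growth => // n; exact: size_codes_of_len.
apply/funext => n; congr (_%:R `^ _).
apply: num_of_length_pin_class.
- exact: codes_of_len_uniq.
- move=> S uS <-; apply/mem_codes_of_len.
  by apply: code_box_sum_code => // j l; exact: mem_sturmian_factors.
- move=> c /mem_codes_of_len cn.
  have [S [uS sS _ eS]] := box_sum_code_realised fac_uniq size_fac fac_size
    fac11 (@sturmian_recurrent R rho) 0 cn.
  by exists S.
Qed.

Lemma pin_letter_inj : injective pin_letter.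
Proof.
move=> x y e; apply/funext => j; have := congr1 (@^~ j.*2) e.
rewrite /pin_letter odd_double /side doubleK.
by case: (x j); case: (y j).
Qed.

Theorem theorem5p2 (R : realType) :
  exists mu : R,
    [/\ largest_root (mu_poly R) mu,
        `|mu - (328 / 10 ^+ 2 + 277 / 10 ^+ 5)| < 5 / 10 ^+ 6 &
        ~ countable [set w : nat -> letter |
            pin_word w /\ has_growth_rate (pin_class w) mu]].
Proof.
have [mu [mu_largest mu_approx mu_bounds]] := exists_mu R.
exists mu; split=> // cW.
pose I : set R := [set` `[0, 1[%R].
pose phi (rho : R) := pin_letter (sturmian rho).
have phiI : {in I &, injective phi}.
  move=> r r'; rewrite !inE /I /= !in_itv /= => hr hr' /pin_letter_inj.
  exact: sturmian_inj.
have cI : countable I.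
  rewrite -(eq_countable (inj_card_eq phiI)); apply: sub_countable cW.
  apply: subset_card_le => _ [r _ <-]; split; first exact: pin_word_letter.
  exact: sturmian_growth mu_largest.1 mu_bounds.
(* A countable set has Lebesgue measure 0, but [I] has measure 1. *)
have := countable_lebesgue_measure0 cI.
rewrite /I lebesgue_measure_itv /= lte_fin ltr01 oppr0 adde0 => /eqP.
by rewrite eqe oner_eq0.
Qed.
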